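(* Let $\mathcal{A}$ be a unital $C^*$-algebra, let $(H,\pi)$ be a non-degenerate representation of $\mathcal{A}$, and let $v,w\in H$. Then $tp(v/\emptyset)=tp(w/\emptyset)$ if and only if $\phi_v=\phi_w$, where for $u\in H$, $\phi_u$ denotes the positive linear functional on $\mathcal{A}$ given by $\phi_u(a)=\langle\pi(a)u\mid u\rangle$.
   Context: A representation of $\mathcal{A}$ is an isometric $*$-homomorphism $\pi:\mathcal{A}\to B(H)$, with $H$ a complex Hilbert space; it is non-degenerate if for every nonzero $v\in H$ there is $a\in\mathcal{A}$ with $\pi(a)v\neq 0$. It is regarded as a one-sorted metric structure of continuous logic, denoted $(H,\pi)$: the universe is the unit ball $Ball_1(H)$ with metric $d(v,w)=\|\frac{v-w}{2}\|$; the symbols are $0$, $v\mapsto -v$, $v\mapsto iv$, $(v,w)\mapsto\frac{v+w}{2}$, the norm predicate, and for every $a\in Ball_1(\mathcal{A})$ a unary function symbol $\dot a$ interpreted as $\pi(a)$. The paper treats $H$ directly rather than only its unit ball (vectors of arbitrary norm being handled by rescaling). $tp(v/\emptyset)$ is the type of $v$ over the empty set in this structure. *)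

(* Defs.v *)
From HB Require Import structures.
From mathcomp Require Import all_boot all_order all_algebra.
From mathcomp Require Import complex.
From mathcomp Require Import all_classical all_reals all_analysis.
Import Order.TTheory GRing.Theory Num.Theory.
Import numFieldNormedType.Exports.

Set Implicit Arguments.
Unset Strict Implicit.
Unset Printing Implicit Defensive.

Local Open Scope classical_set_scope.
Local Open Scope ring_scope.
Local Open Scope complex_scope.

(** Norms over [R[i]] take values in [R[i]]; [rnorm] is the same number in [R]. *)
Definition rnorm (R : realType) (V : normedModType R[i]) (v : V) : R :=
  complex.Re `|v|.

(** The product is a field of the mixin, rather than a [GRing.Algebra]
    structure, because MathComp has no join of normed modules and rings below
    [numDomainType].  The zero algebra is allowed. *)
HB.mixin Record isCStarAlgebra (R : realType) (A : Type)
    of CompleteNormedModule R[i] A := {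
  cone : A;
  cmul : A -> A -> A;
  star : A -> A;
  cmulA : associative cmul;
  cmul1a : left_id cone cmul;
  cmula1 : right_id cone cmul;
  cmulDl : left_distributive cmul +%R;
  cmulDr : right_distributive cmul +%R;
  cmulZl : forall (c : R[i]) (a b : A), cmul (c *: a) b = c *: cmul a b;
  cmulZr : forall (c : R[i]) (a b : A), cmul a (c *: b) = c *: cmul a b;
  starD : forall a b : A, star (a + b) = star a + star b;
  starZ : forall (c : R[i]) (a : A), star (c *: a) = Num.conj c *: star a;
  starM : forall a b : A, star (cmul a b) = cmul (star b) (star a);
  starK : involutive star;
  norm_cmul : forall a b : A, `|cmul a b| <= `|a| * `|b|;
  norm_star_cmul : forall a : A, `|cmul (star a) a| = `|a| ^+ 2;
}.

#[short(type="cstarAlgebraType")]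
HB.structure Definition CStarAlgebra (R : realType) :=
  {A of CompleteNormedModule R[i] A & isCStarAlgebra R A}.

(** The inner product is linear in its first argument. *)
HB.mixin Record isHilbertSpace (R : realType) (H : Type)
    of CompleteNormedModule R[i] H := {
  inner : {dot H for Num.conj};
  normE_inner : forall v : H, `|v| ^+ 2 = inner v v;
}.

#[short(type="hilbertType")]
HB.structure Definition HilbertSpace (R : realType) :=
  {H of CompleteNormedModule R[i] H & isHilbertSpace R H}.

Notation "⟨ v | w ⟩" := (inner v w) (at level 0, v, w at level 99).

Definition opnorm (R : realType) (V W : normedModType R[i]) (f : V -> W) : R :=
  sup [set rnorm (f v) | v in [set v : V | `|v| <= 1]].

(** [rep_star] says that [pi (star a)] is the adjoint of [pi a].  That [pi]
    preserves the unit is not required. *)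
Record representation (R : realType) (A : cstarAlgebraType R)
    (H : hilbertType R) := Representation {
  rep_op :> A -> {linear H -> H};
  rep_continuous : forall a, continuous (rep_op a);
  rep_linear : forall (c : R[i]) (a b : A) (v : H),
    rep_op (c *: a + b) v = c *: rep_op a v + rep_op b v;
  rep_mul : forall (a b : A) (v : H), rep_op (cmul a b) v = rep_op a (rep_op b v);
  rep_star : forall (a : A) (v w : H),
    ⟨rep_op (star a) v | w⟩ = ⟨v | rep_op a w⟩;
  rep_isometric : forall a, opnorm (rep_op a) = rnorm a;
}.

Definition nondegenerate_rep (R : realType) (A : cstarAlgebraType R)
    (H : hilbertType R) (pi : representation A H) : Prop :=
  forall v : H, v != 0 -> exists a : A, pi a v != 0.

Definition vector_functional (R : realType) (A : cstarAlgebraType R)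
    (H : hilbertType R) (pi : representation A H) (u : H) : A -> R[i] :=
  fun a => ⟨pi a u | u⟩.

Definition unit_ball (R : realType) (V : normedModType R[i]) : Type :=
  {v : V | `|v| <= 1}.

Inductive term (R : realType) (A : cstarAlgebraType R) : Type :=
| TVar of nat
| TZero
| TOpp of term A
| TMulI of term A
| TMid of term A & term A
| TDot of unit_ball A & term A.
Arguments TVar {R A}.
Arguments TZero {R A}.

Definition unit_cube (R : realType) (n : nat) : set 'rV[R]_n :=
  [set x | forall i, 0 <= x 0 i <= 1].

(** An [n]-ary connective is a continuous function from [[0, 1]^n] to
    [[0, 1]]; the values outside the cube are irrelevant. *)
Record connective (R : realType) (n : nat) := Connective {
  conn_fun :> 'rV[R]_n -> R;
  conn_range : forall x, unit_cube x -> 0 <= conn_fun x <= 1;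
  conn_continuous : {within @unit_cube R n, continuous conn_fun};
}.

Inductive formula (R : realType) (A : cstarAlgebraType R) : Type :=
| FDist of term A & term A
| FNorm of term A
| FConn n of connective R n & ('I_n -> formula A)
| FSup of nat & formula A
| FInf of nat & formula A.

Fixpoint term_var (R : realType) (A : cstarAlgebraType R) (k : nat)
    (t : term A) : Prop :=
  match t with
  | TVar j => j = k
  | TZero => False
  | TOpp t1 | TMulI t1 | TDot _ t1 => term_var k t1
  | TMid t1 t2 => term_var k t1 \/ term_var k t2
  end.

Fixpoint free_var (R : realType) (A : cstarAlgebraType R) (k : nat)
    (phi : formula A) : Prop :=
  match phi with
  | FDist t1 t2 => term_var k t1 \/ term_var k t2
  | FNorm t => term_var k t
  | FConn n _ args => exists i : 'I_n, free_var k (args i)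
  | FSup j psi | FInf j psi => j <> k /\ free_var k psi
  end.

Section Interpretation.
Variables (R : realType) (A : cstarAlgebraType R) (H : hilbertType R).
Variable pi : representation A H.

Lemma rnormE (V : normedModType R[i]) (v : V) : (rnorm v)%:C = `|v|.
Proof. by rewrite RRe_real// ger0_real. Qed.

Lemma ball_zero_proof : `|0 : H| <= 1.
Proof. by rewrite normr0. Qed.

Lemma ball_opp_proof (x : unit_ball H) : `|- sval x| <= 1.
Proof. by rewrite normrN; exact: (svalP x). Qed.

Lemma ball_muli_proof (x : unit_ball H) : `|'i *: sval x| <= 1.
Proof. by rewrite normrZ normCi mul1r; exact: (svalP x). Qed.

Lemma ball_mid_proof (x y : unit_ball H) :
  `|2^-1 *: (sval x + sval y)| <= 1.
Proof.
rewrite normrZ ger0_norm ?invr_ge0// ler_pdivrMl// mulr1.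
apply: le_trans (ler_normD _ _) _.
by rewrite -[2]/(1 + 1); apply: lerD; [exact: (svalP x)|exact: (svalP y)].
Qed.

Lemma ball_dot_proof (a : unit_ball A) (x : unit_ball H) :
  `|pi (sval a) (sval x)| <= 1.
Proof.
case: a x => [a a1] [x x1] /=.
suff : rnorm (pi a x) <= rnorm a.
  rewrite -lecR !rnormE => h; exact: le_trans h a1.
rewrite -(rep_isometric pi); apply: ub_le_sup; last by exists x.
have /continuous_linear_bounded : {for 0, continuous (pi a)}.
  exact: rep_continuous.
move=> /(_ 0) /bounded_funP /(_ 1) [M hM].
exists (complex.Re M) => _ [y /= y1 <-].
have := hM y y1; rewrite -rnormE; case: M {hM} => m m'.
by rewrite lecE /= => /andP[].
Qed.

Definition ball_zero : unit_ball H := exist _ 0 ball_zero_proof.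
Definition ball_opp (x : unit_ball H) : unit_ball H :=
  exist _ (- sval x) (ball_opp_proof x).
Definition ball_muli (x : unit_ball H) : unit_ball H :=
  exist _ ('i *: sval x) (ball_muli_proof x).
Definition ball_mid (x y : unit_ball H) : unit_ball H :=
  exist _ (2^-1 *: (sval x + sval y)) (ball_mid_proof x y).
Definition ball_dot (a : unit_ball A) (x : unit_ball H) : unit_ball H :=
  exist _ (pi (sval a) (sval x)) (ball_dot_proof a x).

Definition ball_dist (x y : unit_ball H) : R :=
  rnorm (2^-1 *: (sval x - sval y)).

Fixpoint term_eval (rho : nat -> unit_ball H) (t : term A) : unit_ball H :=
  match t with
  | TVar k => rho k
  | TZero => ball_zero
  | TOpp t1 => ball_opp (term_eval rho t1)
  | TMulI t1 => ball_muli (term_eval rho t1)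
  | TMid t1 t2 => ball_mid (term_eval rho t1) (term_eval rho t2)
  | TDot a t1 => ball_dot a (term_eval rho t1)
  end.

Definition update (rho : nat -> unit_ball H) (k : nat) (x : unit_ball H) :
    nat -> unit_ball H :=
  fun j => if j == k then x else rho j.

Fixpoint formula_eval (rho : nat -> unit_ball H) (phi : formula A) : R :=
  match phi with
  | FDist t1 t2 => ball_dist (term_eval rho t1) (term_eval rho t2)
  | FNorm t => rnorm (sval (term_eval rho t))
  | FConn n u args => u (\row_(i < n) formula_eval rho (args i))
  | FSup k psi => sup (range (fun x => formula_eval (update rho k x) psi))
  | FInf k psi => inf (range (fun x => formula_eval (update rho k x) psi))
  end.

(** A type over the empty set is the set of conditions [phi = 0] that [x]
    satisfies.  Other values are covered because [fun t => |t - c|] is a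
    connective. *)
Definition tp (x : unit_ball H) : set (formula A) :=
  [set phi | (forall k, free_var k phi -> k = 0%N) /\
             formula_eval (fun=> x) phi = 0].

Lemma rescale_proof (r : R) (v : H) :
  0 < r -> `|v| <= r%:C -> `|(r^-1)%:C *: v| <= 1.
Proof.
move=> r0 vr; rewrite normrZ ger0_norm ?lecR ?invr_ge0 ?(ltW r0)//.
move: vr; rewrite -(rnormE v) lecR => vr.
have -> : (r^-1)%:C * (rnorm v)%:C = (r^-1 * rnorm v)%:C by rewrite rmorphM.
rewrite -(rmorph1 (real_complex R)).
by rewrite lecR ler_pdivrMl// mulr1.
Qed.

Definition rescale (r : R) (v : H) (r0 : 0 < r) (vr : `|v| <= r%:C) :
    unit_ball H :=
  exist _ ((r^-1)%:C *: v) (rescale_proof r0 vr).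

End Interpretation.

(* Main.v *)
Require Import Defs.
From HB Require Import structures.
From mathcomp Require Import all_boot all_order all_algebra.
From mathcomp Require Import complex.
From mathcomp Require Import all_classical all_reals all_analysis.
From mathcomp Require Import ring lra.
Import Order.TTheory GRing.Theory Num.Theory.
Import numFieldNormedType.Exports.

Set Implicit Arguments.
Unset Strict Implicit.
Unset Printing Implicit Defensive.

Local Open Scope classical_set_scope.
Local Open Scope ring_scope.
Local Open Scope complex_scope.

(** The type of [v] only depends on the moments [Re <pi(a) v | v>], and these are
    recovered from it by polarization.  For the converse, every formula is
    uniformly continuous in the moments [Re <pi(a) x_i | x_j>] of its variables.
    The quantifier step asks, when two tuples [s], [t] have almost the same
    moments, for an [x] such that [(t, x)] has almost the same moments as a given
    [(s, y)].  In an ultrapower of [H] one may assume that the moments of [s] and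
    [t] agree, so that [s_j |-> t_j] extends to an intertwining isometry [U] from
    a closed submodule onto another one.  Write [y = s0 + u] with [s0] in the
    domain of [U] and [u] orthogonal to it.  The orthogonal complement of the
    range of [U] may be too small to contain an exact copy of [u].  For [r < 1],
    however, there is an [h] in the domain with [Y_r := u + r h - U h] orthogonal
    to the range, and then
      [<a u | u> = <a Y_r | Y_r> + (1 - r^2) <a h | h>],
    while [X_r := sqrt (1 - r^2) h] tends weakly to 0 as [r] tends to 1.  So
    [x := U s0 + Y_r + X_r'] works when [r'] is much closer to 1 than [r], provided
    that the moments of [Y_r] and [Y_r'] are close, which holds along an
    ultrafilter. *)

(** * Discriminants, null sequences and limits along ultrafilters *)

Lemma quadratic_ge0_discr (R : realFieldType) (a b c : R) : 0 <= c ->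
  (forall t, 0 <= a - 2 * t * b + t ^+ 2 * c) -> b ^+ 2 <= a * c.
Proof.
rewrite le_eqVlt => /predU1P[<- h|c0 h].
  have [->|b0] := eqVneq b 0; first by rewrite expr0n mulr0.
  (* With c = 0 the polynomial is affine in [t], and this [t] gives it the value -1. *)
  have := h ((a + 1) / (2 * b)).
  have -> : a - 2 * ((a + 1) / (2 * b)) * b + ((a + 1) / (2 * b)) ^+ 2 * 0 = -1.
    by field.
  by rewrite lerNr oppr0 ler10.
have := h (b / c).
have -> : a - 2 * (b / c) * b + (b / c) ^+ 2 * c = (a * c - b ^+ 2) / c.
  by field; apply: lt0r_neq0.
by rewrite pmulr_lge0 ?invr_gt0// subr_ge0.
Qed.

Lemma vanishing_seq (R : realType) : exists u : nat -> R,
  (forall n, 0 < u n < 1) /\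
  forall e, 0 < e -> exists N, forall n, (N <= n)%N -> u n < e.
Proof.
(* The shift by two makes the bound by 1 strict already at n = 0. *)
exists (fun n => n.+2%:R^-1); split=> [n|e e0].
  by rewrite invr_gt0 ltr0n/= invf_lt1 ?ltr0n// ltr1n.
have [N _ HN] := near_infty_natSinv_lt (PosNum e0); exists N => n Nn.
by apply: (HN n.+1); exact: leqW.
Qed.

Lemma fmap_ultra (T U : Type) (F : set_system T) (f : T -> U) :
  UltraFilter F -> UltraFilter (f @ F).
Proof.
move=> FU; split; first exact: fmap_proper_filter.
move=> G GF FG; apply/seteqP; split=> // A GA.
have [//|FA] := in_ultra_setVsetC (f @^-1` A) FU.
have GA' : G (~` A) by exact: FG.
by have [x []] := filter_ex (filterI GA GA').
Qed.

Lemma ultra_bounded_cvg (R : realType) (T : Type) (F : set_system T)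
    (f : T -> R) M :
  UltraFilter F -> (forall t, `|f t| <= M) -> exists l : R, f @ F --> l.
Proof.
move=> FU fM; have FfU := fmap_ultra f FU.
have := @segment_compact R (- M) M; rewrite compact_ultra => /(_ _ FfU).
case=> [|l [_ Fl]]; last by exists l.
apply: (@filterS _ F _ setT) (filterT) => t _ /=.
by rewrite in_itv/= -ler_norml.
Qed.

Lemma filter_forall_mem (T : Type) (F : set_system T) (U : eqType)
    (A : U -> set T) (s : seq U) : Filter F -> (forall u, u \in s -> F (A u)) ->
  F [set t | forall u, u \in s -> A u t].
Proof.
move=> FF; elim: s => [|u s IH] FA; first exact: filterE.
have Fs : F [set t | forall u, u \in s -> A u t].
  by apply: IH => w ws; apply: FA; rewrite inE ws orbT.
apply: (@filterS T F FF _ _ _ (@filterI T F FF _ _ (FA u (mem_head _ _)) Fs)).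
by move=> t /= [Au As] w; rewrite inE => /predU1P[->|/As].
Qed.

Lemma sqr_small_eq0 (R : realType) (x K : R) : 0 <= K ->
  (forall e, 0 < e -> x ^+ 2 <= e * K) -> x = 0.
Proof.
move=> K0 h; apply/eqP; rewrite -sqrf_eq0; apply/eqP/le_anti.
rewrite sqr_ge0 andbT leNgt; apply/negP => x0.
have K1 : 0 < K + 1 by lra.
have := h (x ^+ 2 / (K + 1)); rewrite divr_gt0// => /(_ isT).
rewrite mulrAC ler_pdivlMr//; nra.
Qed.

(** * Partial isometries in a complete semi-inner product space *)

Section SemiInner.
Variables (R : realType) (V : lmodType R) (B : V -> V -> R).
Hypothesis BC : forall x y, B x y = B y x.
Hypothesis BDl : forall x y z, B (x + y) z = B x z + B y z.
Hypothesis BZl : forall k x y, B (k *: x) y = k * B x y.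
Hypothesis B_ge0 : forall x, 0 <= B x x.

Let BDr x y z : B x (y + z) = B x y + B x z.
Proof. by rewrite BC BDl !(BC x). Qed.

Let BZr k x y : B x (k *: y) = k * B x y.
Proof. by rewrite BC BZl BC. Qed.

Let BNl x y : B (- x) y = - B x y.
Proof. by rewrite -scaleN1r BZl mulN1r. Qed.

Let BNr x y : B x (- y) = - B x y.
Proof. by rewrite BC BNl BC. Qed.

Let B0l x : B 0 x = 0.
Proof. by rewrite -(scale0r 0) BZl mul0r. Qed.

Let BE := (BDl, BDr, BZl, BZr, BNl, BNr).

Ltac form_lra := repeat match goal with
  | |- context [B ?x ?y] => move: (B x y) => ? end; intros; lra.

Lemma semi_inner_CS x y : B x y ^+ 2 <= B x x * B y y.
Proof.
apply: quadratic_ge0_discr => // t.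
by have := B_ge0 (x - t *: y); rewrite !BE (BC y x); lra.
Qed.

(** Expand t |u / t - w|^2 >= 0 for [u] and for [- u]. The weight [t] allows a small [u] to be
    paired with a [w] that is merely bounded. *)
Lemma semi_inner_young u w (t : R) : 0 < t ->
  `|B u w| <= (B u u / t + t * B w w) / 2.
Proof.
move=> t0.
have h z : 2 * B z w <= B z z / t + t * B w w.
  have /(mulr_ge0 (ltW t0)) := B_ge0 (t^-1 *: z - w).
  rewrite !BE (BC w z).
  have -> : t * (t^-1 * (t^-1 * B z z) - t^-1 * B z w - (t^-1 * B z w - B w w)) =
    B z z / t - 2 * B z w + t * B w w by field; exact: lt0r_neq0.
  by lra.
have := h u; have := h (- u); rewrite !BE ler_norml opprK => *.
by apply/andP; split; lra.
Qed.

(** Convexity of the squared norm at u + r h = (1 - r) (u / (1 - r)) + r h. *)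
Lemma semi_inner_convex (r : R) u h : 0 <= r < 1 ->
  B (u + r *: h) (u + r *: h) <= B u u / (1 - r) + r * B h h.
Proof.
move=> /andP[r0 r1].
have r1' : 0 < 1 - r by lra.
have /(mulr_ge0 (divr_ge0 r0 (ltW r1'))) := B_ge0 (u - (1 - r) *: h).
rewrite !BE (BC h u) -subr_ge0 => h0.
rewrite -subr_ge0; apply: le_trans h0 _.
rewrite subr0 le_eqVlt; apply/orP; left; apply/eqP.
by field; apply: lt0r_neq0.
Qed.

Lemma semi_inner_proj_le w k : B k k = B w k -> B k k <= B w w.
Proof.
move=> e; have := B_ge0 (w - k); rewrite !BE (BC k w); lra.
Qed.

Lemma semi_inner_near_min w g (d e : R) :
  (forall t, d <= B (w - t *: g) (w - t *: g)) -> B w w <= d + e ->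
  B w g ^+ 2 <= e * B g g.
Proof.
move=> dB we; apply: quadratic_ge0_discr => // t.
have := dB t; rewrite !BE (BC g w); lra.
Qed.

Definition semi_cvg (x : nat -> V) (y : V) :=
  forall e : R, 0 < e -> exists N, forall n, (N <= n)%N ->
    B (x n - y) (x n - y) < e.

Definition semi_cauchy (x : nat -> V) :=
  forall e : R, 0 < e -> exists N, forall m n, (N <= m)%N -> (N <= n)%N ->
    B (x m - x n) (x m - x n) < e.

(* A partial isometry is encoded by its graph, a relation closed for [B]. *)
Record partial_isometry (G : V -> V -> Prop) : Prop := {
  pisom0 : G 0 0;
  pisomD : forall x x' y y', G x x' -> G y y' -> G (x + y) (x' + y');
  pisomZ : forall k x x', G x x' -> G (k *: x) (k *: x');
  pisomE : forall x x' y y', G x x' -> G y y' -> B x y = B x' y';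
  pisom_closed : forall (f f' : nat -> V) x x', (forall n, G (f n) (f' n)) ->
    semi_cvg f x -> semi_cvg f' x' -> G x x' }.

(** Passing to the inverse turns projections onto the domain into projections onto the range. *)
Lemma partial_isometry_sym G :
  partial_isometry G -> partial_isometry (fun x y => G y x).
Proof.
case=> G0 GD GZ GE Gc; split => //.
- by move=> x x' y y'; exact: GD.
- by move=> k x x'; exact: GZ.
- by move=> x x' y y' xx' yy'; rewrite (GE _ _ _ _ xx' yy').
- by move=> f f' x x' fG fx fx'; exact: (Gc f' f).
Qed.

(** * Orthogonal projections and the resolvent equation *)

Hypothesis B_complete : forall x, semi_cauchy x -> exists y, semi_cvg x y.

(** The projection theorem for the domain of [G]: a minimizing sequence is Cauchy by the
    parallelogram law, its images are Cauchy by isometry, and closedness of the graph puts the pair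
    of limits in [G]. *)
Lemma pisom_proj G z : partial_isometry G ->
  exists x x', G x x' /\ forall g g', G g g' -> B (z - x) g = 0.
Proof.
move=> pG; have [v [v0 v_small]] := vanishing_seq R.
pose S := [set B (z - p.1) (z - p.1) | p in [set p : V * V | G p.1 p.2]].
have [d [infS apx]] : exists d : R,
    (forall x x', G x x' -> d <= B (z - x) (z - x)) /\
    (forall e : R, 0 < e -> exists x x', G x x' /\ B (z - x) (z - x) < d + e).
  have hinf : has_inf S.
    split; last by exists 0 => _ [p _ <-]; exact: B_ge0.
    by exists (B (z - 0) (z - 0)); exists (0, 0) => //=; exact: pisom0.
  exists (inf S); split=> [x x' Gx | e e0].
    by apply: ge_inf; [case: hinf | exists (x, x')].
  by have [_ [[x x'] /= Gx <-] xe] := inf_adherent e0 hinf; exists x, x'.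
have /choice [f fP] : forall n : nat, exists p : V * V,
    G p.1 p.2 /\ B (z - p.1) (z - p.1) < d + v n.
  move=> n; have [|x [x' [Gx xn]]] := apx (v n); first by case/andP: (v0 n).
  by exists (x, x').
have fcau (e : R) : 0 < e -> exists N, forall m n, (N <= m)%N -> (N <= n)%N ->
    B ((f m).1 - (f n).1) ((f m).1 - (f n).1) < e.
  move=> e0; have e4 : 0 < e / 4 by lra.
  have [N inv] := v_small _ e4; exists N => m n Nm Nn.
  have [Gm Hm] := fP m; have [Gn Hn] := fP n.
  (* The midpoint stays in the domain, so its squared distance to [z] is at least [d]; the
     parallelogram law then bounds the squared difference by 2 (v m + v n). *)
  have Gmid : G (2^-1 *: ((f m).1 + (f n).1)) (2^-1 *: ((f m).2 + (f n).2)).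
    by apply: pisomZ => //; exact: pisomD.
  have := infS _ _ Gmid.
  have := inv _ Nm; have := inv _ Nn.
  move: Hm Hn => /=; rewrite !BE.
  by rewrite (BC (f n).1 (f m).1) (BC z (f m).1) (BC z (f n).1); form_lra.
have fcau' (e : R) : 0 < e -> exists N, forall m n, (N <= m)%N -> (N <= n)%N ->
    B ((f m).2 - (f n).2) ((f m).2 - (f n).2) < e.
  move=> /fcau[N HN]; exists N => m n Nm Nn.
  have Gd : G ((f m).1 - (f n).1) ((f m).2 - (f n).2).
    rewrite -(scaleN1r (f n).1) -(scaleN1r (f n).2).
    apply: (pisomD pG); first exact: (fP m).1.
    by apply: (pisomZ pG); exact: (fP n).1.
  by rewrite -(pisomE pG Gd Gd); exact: HN.
have [x fx] := B_complete fcau; have [x' fx'] := B_complete fcau'.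
exists x, x'; split; first by apply: (pisom_closed pG _ fx fx') => n; exact: (fP n).1.
move=> g g' Gg.
(* The factor 4 comes from (p + q)^2 <= 2 p^2 + 2 q^2, with [z - x] split at [(f n).1]. *)
apply: (@sqr_small_eq0 _ _ (4 * B g g)) => [|e e0]; first by rewrite mulr_ge0.
have [N HN] := fx _ e0; have [N' HN'] := v_small _ e0.
  pose n := maxn N N'.
  have ne : v n < e by apply: HN'; exact: leq_maxr.
  have [Gn Hn] := fP n.
  have h1 : B (z - (f n).1) g ^+ 2 <= e * B g g.
    apply: (@semi_inner_near_min _ _ d) => [t|]; last by lra.
    rewrite -addrA -opprD; apply: infS ((f n).2 + t *: g') _.
    by apply: (pisomD pG) => //; exact: (pisomZ pG).
  have h2 : B ((f n).1 - x) g ^+ 2 <= e * B g g.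
    apply: le_trans (semi_inner_CS _ _) _.
    by apply: ler_wpM2r => //; apply/ltW/HN; rewrite leq_maxl.
  have -> : B (z - x) g = B (z - (f n).1) g + B ((f n).1 - x) g.
    by rewrite -BDl addrA subrK.
  by nra.
Qed.

(** [h] is the fixed point of h |-> U^-1 P (u + r h), where U is the partial isometry and P the
    projection onto its range. This map contracts by the factor [r], so its iterates from 0
    converge. *)
Lemma pisom_resolvent G u (r : R) : partial_isometry G -> 0 <= r < 1 ->
  exists h h', G h h' /\ forall g g', G g g' -> B (u + r *: h - h') g' = 0.
Proof.
move=> pG r01; have /andP[r0 r1] := r01.
have /choice [f fP] : forall h, exists p : V * V,
    G p.1 p.2 /\ forall g g', G g g' -> B (u + r *: h - p.2) g' = 0.
  move=> h; have [k' [k [Gk kP]]] := pisom_proj (u + r *: h) (partial_isometry_sym pG).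
  by exists (k, k'); split=> // g g' /kP.
have GN x x' y y' : G x x' -> G y y' -> G (x - y) (x' - y').
  move=> Gx Gy; rewrite -(scaleN1r y) -(scaleN1r y').
  by apply: (pisomD pG) => //; exact: (pisomZ pG).
pose s n := iter n (fun p => f p.1) (0, 0).
have Gs n : G (s n).1 (s n).2.
  by case: n => [|n]; [exact: (pisom0 pG) | exact: (fP _).1].
have sE n : B (s n).1 (s n).1 = B (s n).2 (s n).2 by exact: (pisomE pG).
(* [M] solves M = B u u / (1 - r) + r M, so [semi_inner_convex] preserves it as a bound along the
   iteration. *)
pose M := B u u / (1 - r) ^+ 2.
have M0 : 0 <= M by rewrite divr_ge0// sqr_ge0.
have bnd n : B (s n).1 (s n).1 <= M.
  elim: n => [|n IH]; first by rewrite /= B0l.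
  rewrite sE; apply: (@le_trans _ _ (B (u + r *: (s n).1) (u + r *: (s n).1))).
    apply: semi_inner_proj_le; apply/eqP; rewrite -subr_eq0 -BNl -BDl.
    have [Gk kP] := fP (s n).1.
    by rewrite -opprB BNl oppr_eq0; apply/eqP/(kP _ _ Gk).
  apply: (le_trans (semi_inner_convex _ _ r01)).
  have -> : M = B u u / (1 - r) + r * M by rewrite /M; field; apply: lt0r_neq0; lra.
  by rewrite lerD2l ler_wpM2l.
have contr h1 h2 : B ((f h1).1 - (f h2).1) ((f h1).1 - (f h2).1) <=
    r ^+ 2 * B (h1 - h2) (h1 - h2).
  have [G1 P1] := fP h1; have [G2 P2] := fP h2; have G12 := GN _ _ _ _ G1 G2.
  rewrite (pisomE pG G12 G12).
  have -> : r ^+ 2 * B (h1 - h2) (h1 - h2) =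
            B (r *: (h1 - h2)) (r *: (h1 - h2)) by rewrite BZl BZr mulrA.
  apply: semi_inner_proj_le.
  have := P1 _ _ G12; have := P2 _ _ G12.
  have : B ((f h1).2 - (f h2).2) ((f h1).2 - (f h2).2) =
    B (f h1).2 ((f h1).2 - (f h2).2) - B (f h2).2 ((f h1).2 - (f h2).2).
    by rewrite BDl BNl.
  move: ((f h1).2 - (f h2).2) => k; rewrite !(BDl, BZl, BNl); form_lra.
have geo n j : B ((s (n + j)%N).1 - (s n).1) ((s (n + j)%N).1 - (s n).1) <=
    (r ^+ 2) ^+ n * M.
  elim: n => [|n IH]; first by rewrite add0n subr0 expr0 mul1r.
  rewrite addSn; apply: (le_trans (contr _ _)).
  by rewrite (exprS (r ^+ 2) n) -mulrA; apply: ler_wpM2l => //; exact: sqr_ge0.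
have cau : semi_cauchy (fun n => (s n).1).
  move=> e e0.
  have q1 : `|r ^+ 2| < 1 by rewrite ger0_norm ?sqr_ge0//; nra.
  have q0 : 0 < e / (4 * M + 1) by apply: divr_gt0 => //; lra.
  have /cvgrPdist_lt/(_ _ q0)[N _ HN] := cvg_expr q1.
  exists N => m n Nm Nn.
  have := geo N (m - N)%N; have := geo N (n - N)%N; rewrite !subnKC//.
  have {HN} := HN N (leqnn N).
  rewrite /= sub0r normrN ger0_norm ?exprn_ge0 ?sqr_ge0// ltr_pdivlMr; last by lra.
  (* Nonnegativity of this square amounts to |s m - s n|^2 <= 2 |s m - s N|^2 + 2 |s n - s N|^2. *)
  have := B_ge0 ((s m).1 + (s n).1 - (2:R) *: (s N).1).
  have := exprn_ge0 N (sqr_ge0 r).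
  rewrite !BE (BC (s n).1 (s m).1) (BC (s N).1 (s m).1) (BC (s N).1 (s n).1).
  move: ((r ^+ 2) ^+ N) => q *; nra.
have cau' : semi_cauchy (fun n => (s n).2).
  move=> e /cau[N HN]; exists N => m n Nm Nn.
  have Gmn := GN _ _ _ _ (Gs m) (Gs n).
  by rewrite -(pisomE pG Gmn Gmn); exact: HN.
have [h fh] := B_complete cau; have [h' fh'] := B_complete cau'.
exists h, h'; split; first by exact: (pisom_closed pG Gs fh fh').
move=> g g' Gg; apply: (@sqr_small_eq0 _ _ (4 * B g' g')) => [|e e0].
  by rewrite mulr_ge0.
have [N HN] := fh _ e0; have [N' HN'] := fh' _ e0.
pose n := maxn N N'.
(* The image is taken one index later: the orthogonality known for the iterates relates [(s n).1] to
   [(s n.+1).2]. *)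
have := HN n (leq_maxl _ _); have := HN' n.+1 (leqW (leq_maxr _ _)).
have /= := (fP (s n).1).2 _ _ Gg.
have := semi_inner_CS ((s n).1 - h) g'.
have := semi_inner_CS ((s n.+1).2 - h') g'.
have := B_ge0 g'; have := B_ge0 ((s n).1 - h).
move: (B ((s n).1 - h) ((s n).1 - h)) (B ((s n.+1).2 - h') ((s n.+1).2 - h')).
rewrite !BE -[f _]/(s n.+1).
move: (B g' g') (B (s n).1 g') (B (s n.+1).2 g') (B h g') (B h' g') (B u g').
move=> gg a b c d v X Y X0 gg0 CY CX E Ye Xe.
have -> : v + r * c - d = (b - d) - r * (a - c) by lra.
move: (b - d) (a - c) CY CX => p q CY CX.
have rq : (r * q) ^+ 2 <= q ^+ 2.
  by rewrite exprMn ler_piMl ?sqr_ge0// expr_le1// ltW.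
have := sqr_ge0 (p + r * q).
have := ler_wpM2r gg0 (ltW Ye); have := ler_wpM2r gg0 (ltW Xe).
move: (r * q) rq => t; nra.
Qed.

(** * Operators commuting with a partial isometry *)

Record pisom_op (G : V -> V -> Prop) (a a' : V -> V) : Prop := {
  op_adj : forall x y, B (a x) y = B x (a' y);
  op_stable : forall x x', G x x' -> G (a x) (a x');
  op_stable_adj : forall x x', G x x' -> G (a' x) (a' x');
  op_bounded : exists C, forall x, B (a x) (a x) <= C * B x x }.

(** Lets the statements about moments specialize to norms. *)
Lemma pisom_op_id G : pisom_op G id id.
Proof. by split => //; exists 1 => x; rewrite mul1r. Qed.

(** Expand <a S | S> for S = u + r h = Y + U h. The cross terms vanish because domain and range are
    stable under [a] and [a'], and <a U h | U h> = <a h | h>. *)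
Lemma pisom_energy G a a' u (r : R) h h' :
  partial_isometry G -> pisom_op G a a' ->
  (forall g g', G g g' -> B u g = 0) -> G h h' ->
  (forall g g', G g g' -> B (u + r *: h - h') g' = 0) ->
  B (a u) u =
  B (a (u + r *: h - h')) (u + r *: h - h') + (1 - r ^+ 2) * B (a h) h.
Proof.
move=> pG [adj st st' _] u0 Gh Y0.
set Y := u + r *: h - h' in Y0 *.
have E : u + r *: h = Y + h' by rewrite subrK.
clearbody Y.
have aD x y z : B (a (x + y)) z = B (a x) z + B (a y) z by rewrite !adj BDl.
have aZ k x z : B (a (k *: x)) z = k * B (a x) z by rewrite !adj BZl.
have := congr1 (fun S => B (a S) S) E; rewrite !aD !aZ !BE.
rewrite (BC (a h) u) (u0 _ _ (st _ _ Gh)) (adj u h) (u0 _ _ (st' _ _ Gh)).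
rewrite (adj Y h') (Y0 _ _ (st' _ _ Gh)) (BC (a h') Y) (Y0 _ _ (st _ _ Gh)).
rewrite -(pisomE pG (st _ _ Gh) Gh); form_lra.
Qed.

(* Put [z_0 = z] and let [z_(n+1)] be the image under the partial isometry of the
   projection of [z_n] to its domain.  With [al_n] the product of [u] with the
   defect of this projection, [B h z_n = al_(n+1) + r * B h z_(n+1)], and the
   [al_n] are square-summable. *)
Lemma pisom_weak_null G u z (d : R) : partial_isometry G -> 0 < d ->
  (forall g g', G g g' -> B u g = 0) ->
  exists2 rho : R, 0 <= rho < 1 & forall (r : R) h h', rho < r < 1 -> G h h' ->
    (forall g g', G g g' -> B (u + r *: h - h') g' = 0) ->
    (1 - r) * B h z ^+ 2 <= d.
Proof.
move=> pG d0 u0.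
have /choice [f fP] : forall z, exists p : V * V,
    G p.1 p.2 /\ forall g g', G g g' -> B (z - p.1) g = 0.
  by move=> y; have [p [p' pP]] := pisom_proj y pG; exists (p, p').
pose zs n := iter n (fun y => (f y).2) z.
pose e n := B (zs n) (zs n).
pose al n := B u (zs n - (f (zs n)).1).
have e0 n : 0 <= e n by exact: B_ge0.
have eS n : e n = B (zs n - (f (zs n)).1) (zs n - (f (zs n)).1) + e n.+1.
  rewrite /e /= -/(zs n); have [Gp pP] := fP (zs n).
  rewrite -(pisomE pG Gp Gp); have := pP _ _ Gp.
  rewrite !BE (BC (f (zs n)).1); form_lra.
have e_anti n m : (n <= m)%N -> e m <= e n.
  elim: m => [|m IH]; first by rewrite leqn0 => /eqP->.
  rewrite leq_eqVlt => /predU1P[->//|/IH]; apply: le_trans.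
  by rewrite (eS m) lerDr.
have al_le n : al n ^+ 2 <= B u u * (e n - e n.+1).
  by rewrite {1}eS addrK; exact: semi_inner_CS.
pose U := B u u; have U0 : 0 <= U by exact: B_ge0.
(* The final estimate adds [dl] from the first [M] steps and 2 (U + 1) [dl] from the tail. *)
pose dl := d / (2 * U + 3).
have dl0 : 0 < dl by apply: divr_gt0 => //; lra.
have [M HM] : exists M, forall m, (M <= m)%N -> e M - e m <= dl.
  have hinf : has_inf (range e).
    by split; [exists (e 0%N), 0%N | exists 0 => _ [n _ <-]].
  have [_ [M _ <-] eM] := inf_adherent dl0 hinf; exists M => m _.
  have : inf (range e) <= e m by apply: ge_inf; [case: hinf | exists m].
  by move: (inf _) (e M) (e m) eM => *; lra.
pose A := U * e 0%N + 1.
have A1 : 1 <= A by rewrite lerDr mulr_ge0.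
have al_A n : `|al n| <= A.
  rewrite -ler_sqr ?nnegrE//; last by lra.
  rewrite real_normK ?num_real//; apply: (le_trans (al_le n)).
  apply: (@le_trans _ _ (U * e 0%N)).
    by apply: ler_wpM2l => //; have := e0 n.+1; have := e_anti 0%N n (leq0n _); form_lra.
  have : 0 <= U * e 0%N by rewrite mulr_ge0.
  by rewrite /A; move: (U * _) => *; nra.
pose K := 2 * (M%:R * A) ^+ 2.
have K0 : 0 <= K by rewrite mulr_ge0// sqr_ge0.
(* Gives 0 < q < 1 and q K <= dl, so 1 - r < q makes the contribution of the first [M] steps at most
   [dl]. *)
pose q := dl / (K + 1 + dl).
have Kd : 0 < K + 1 + dl by lra.
have q0 : 0 < q by exact: divr_gt0.
have q1 : q < 1 by rewrite ltr_pdivrMr//; lra.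
have qK : q * K <= dl by rewrite /q mulrAC ler_pdivrMr//; nra.
exists (1 - q) => [|r h h' /andP[rho r1] Gh Y0]; first by apply/andP; split; lra.
pose be n := B h (zs n).
have r0 : 0 < r by lra.
(* [h] sees only the projection of z_n to the domain, which U carries to z_(n+1); orthogonality of u
   + r h - U h to the range then gives the recursion. *)
have beS n : be n = al n.+1 + r * be n.+1.
  have [Gp pP] := fP (zs n); have [Gp1 _] := fP (zs n.+1).
  have := pP _ _ Gh; have := Y0 _ _ Gp; have := pisomE pG Gh Gp.
  have := u0 _ _ Gp1; rewrite /be /al -![(f (zs n)).2]/(zs n.+1).
  rewrite !BE (BC _ h) (BC _ h); form_lra.
(* Convexity again: (x + r y)^2 <= x^2 / (1 - r) + r y^2. *)
have be_step n : (1 - r) * be n ^+ 2 <=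
    U * (e n.+1 - e n.+2) + r * ((1 - r) * be n.+1 ^+ 2).
  apply: le_trans (_ : al n.+1 ^+ 2 + r * ((1 - r) * be n.+1 ^+ 2) <= _).
    rewrite beS; move: (al _) (be _) => x y.
    have := mulr_ge0 (ltW r0) (sqr_ge0 (x - (1 - r) * y)); nra.
  by rewrite lerD2r.
have be_tail m n : (1 - r) * be n ^+ 2 <=
    U * (e n.+1 - e (n.+1 + m)%N) + r ^+ m * ((1 - r) * be (n + m)%N ^+ 2).
  elim: m n => [|m IH] n; first by rewrite !addn0 subrr mulr0 add0r mul1r.
  have := ler_wpM2l (ltW r0) (IH n.+1); rewrite -!addSnnS [r ^+ m.+1]exprS.
  have : 0 <= U * (e n.+2 - e (n.+2 + m)%N).
    by rewrite mulr_ge0// subr_ge0 e_anti// leq_addr.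
  move: (be_step n); move: (be n ^+ 2) (be n.+1 ^+ 2) (be (n.+1 + m)%N ^+ 2).
  move: (e (n.+2 + m)%N) (e n.+1) (e n.+2) (r ^+ m) => e1 e2 e3 rm x y w *.
  nra.
(* The energy identity for the identity operator gives (1 - r^2) B h h <= U, so the bound is uniform
   in [r]. *)
have be_bnd n : (1 - r) * be n ^+ 2 <= U * e 0%N.
  have := pisom_energy (a := id) (a' := id) pG _ u0 Gh Y0.
  move=> /(_ (pisom_op_id G)); have := B_ge0 (u + r *: h - h'); move: (B (_ - _) _) => Y YY0 uE.
  have := semi_inner_CS h (zs n); rewrite -/(be n) -/(e n).
  have := ler_wpM2l (B_ge0 h) (e_anti 0%N n (leq0n _)).
  have := e0 0%N; have := B_ge0 h; move: uE; rewrite -/U.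
  move: (B h h) (be n) (e 0%N) (e n) => hh b ez en uE hh0 ez0 le1 le2.
  have : U = Y + (1 - r ^+ 2) * hh by [].
  have le3 : (1 - r) * b ^+ 2 <= (1 - r) * (hh * ez).
    by apply: ler_wpM2l; [lra | apply: le_trans le2 le1].
  move=> ->; apply: (le_trans le3); rewrite -subr_ge0.
  have -> : (Y + (1 - r ^+ 2) * hh) * ez - (1 - r) * (hh * ez) =
            Y * ez + r * (1 - r) * (hh * ez) by ring.
  by rewrite addr_ge0 ?mulr_ge0//; lra.
(* Here the length [N] of the tail may depend on [r]: the defects after [M] cost at most U dl for
   every length, and r^N makes the remainder small. *)
have beM : (1 - r) * be M ^+ 2 <= U * dl + dl.
  have q1' : `|r| < 1 by rewrite ger0_norm; lra.
  have qq0 : 0 < dl / (U * e 0%N + 1).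
    by apply: divr_gt0 => //; have := mulr_ge0 U0 (e0 0%N); lra.
  have /cvgrPdist_lt/(_ _ qq0)[N _ /(_ N (leqnn N))] := cvg_expr q1'.
  rewrite /= sub0r normrN ger0_norm ?exprn_ge0 ?(ltW r0)// ltr_pdivlMr; last first.
    by have := mulr_ge0 U0 (e0 0%N); lra.
  have := be_tail N M; have := be_bnd (M + N)%N.
  have : e M.+1 - e (M.+1 + N)%N <= dl.
    apply: (@le_trans _ _ (e M - e (M.+1 + N)%N)); first by rewrite lerD2r e_anti.
    by apply: HM; rewrite addSn -addnS leq_addr.
  move=> /(ler_wpM2l U0); move: (U * (_ - _)) => T Tle.
  have := exprn_ge0 N (ltW r0); move: (r ^+ N) ((1 - r) * be (M + N)%N ^+ 2) => rN X rN0 Xle bb.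
  have := ler_wpM2l rN0 Xle; move: (U * e 0%N) Xle => Z Xle; nra.
(* A crude bound suffices for the first [M] steps, as [M] and [A] do not depend on [r]. *)
have be0 m : `|be 0%N| <= m%:R * A + `|be m|.
  elim: m => [|m IH]; first by rewrite mul0r add0r.
  apply: (le_trans IH); rewrite beS -natr1.
  have := ler_normD (al m.+1) (r * be m.+1); have := al_A m.+1.
  rewrite normrM (gtr0_norm r0).
  have := ler_wpM2r (normr_ge0 (be m.+1)) (ltW r1); rewrite mul1r.
  by move: (`|al _|) (`|be _|) (`|_ + _|) (m%:R) => *; nra.
rewrite -[B h z]/(be 0%N) -(real_normK (num_real (be 0%N))).
have := be0 M; have := normr_ge0 (be 0%N); move: beM; rewrite -(real_normK (num_real (be M))).
have : 0 <= M%:R * A by rewrite mulr_ge0//; lra.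
have dE : d = (2 * U + 3) * dl by rewrite /dl mulrC divfK//; lra.
have : (1 - r) * (2 * (M%:R * A) ^+ 2) <= dl.
  by apply: le_trans qK; apply: ler_wpM2r => //; lra.
rewrite dE; move: (`|be 0%N|) (`|be M|) (M%:R * A) => x y t h1 t0 h2 x0 xy.
have xx : x ^+ 2 <= 2 * t ^+ 2 + 2 * y ^+ 2 by have := sqr_ge0 (t - y); nra.
have r1' : 0 <= 1 - r by lra.
have := ler_wpM2l r1' xx; nra.
Qed.

(** * Extending the isometry to one more vector *)

Lemma pisom_extension G (T : eqType) (a a' : T -> V -> V) (ts : seq T)
    (L : seq (V * V)) y (e : R) :
  partial_isometry G -> (forall i, pisom_op G (a i) (a' i)) ->
  (forall p, p \in L -> G p.1 p.2) -> 0 < e ->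
  exists x, (forall i, i \in ts -> `|B (a i x) x - B (a i y) y| < e) /\
            (forall p, p \in L -> `|B x p.2 - B y p.1| < e).
Proof.
move=> pG opa GL e0.
have [s0 [t0 [G0 P0]]] := pisom_proj y pG.
set u := y - s0 in P0.
have yE : y = s0 + u by rewrite addrC subrK.
clearbody u; subst y.
have [v [v01 v_small]] := vanishing_seq R.
pose r n := 1 - v n.
have r01 n : 0 < r n < 1 by have := v01 n; rewrite /r; lra.
have /choice [f fP] : forall n, exists p : V * V, G p.1 p.2 /\
    forall g g', G g g' -> B (u + r n *: p.1 - p.2) g' = 0.
  move=> n; have r01' : 0 <= r n < 1 by have := r01 n; lra.
  by have [h [h' [Gh Y0]]] := pisom_resolvent u pG r01'; exists (h, h').
pose Y n := u + r n *: (f n).1 - (f n).2.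
have YG n : forall g g', G g g' -> B (Y n) g' = 0 by case: (fP n).
pose c n := Num.sqrt (1 - r n ^+ 2).
have cE n : c n * c n = 1 - r n ^+ 2.
  by rewrite -expr2 sqr_sqrtr//; have := r01 n; nra.
pose X n := c n *: (f n).1.
(* Since 1 - r^2 <= 2 (1 - r), the bound d^2 / 4 from [pisom_weak_null] leaves d^2 / 2 < d^2. *)
have X_null z (d : R) : 0 < d -> \forall n \near \oo, `|B (X n) z| < d.
  move=> d0; have d4 : 0 < d ^+ 2 / 4 by rewrite divr_gt0// exprn_gt0.
  have [rho /andP[rho0 rho1] H] := pisom_weak_null z pG d4 P0.
  have [N HN] : exists N, forall n, (N <= n)%N -> v n < 1 - rho.
    by apply: v_small; rewrite subr_gt0.
  exists N => // n /= /HN vn; have [Gh Y0] := fP n.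
  have := H (r n) _ _ _ Gh Y0; have /andP[r0 r1] := r01 n.
  rewrite r1 andbT => /(_ _); have rho_r : rho < r n by rewrite /r; lra.
  move=> /(_ rho_r) le.
  rewrite -ltr_sqr ?nnegrE ?(ltW d0)// real_normK ?num_real//.
  rewrite /X BZl exprMn [c n ^+ 2]expr2 cE.
  apply: (@le_lt_trans _ _ (2 * ((1 - r n) * B (f n).1 z ^+ 2))).
    rewrite mulrA ler_wpM2r ?sqr_ge0//; nra.
  by have := exprn_gt0 2 d0; move: le; move: (_ * _) (d ^+ 2) => p q *; lra.
have energy i n : B (a i u) u =
    B (a i (Y n)) (Y n) + (1 - r n ^+ 2) * B (a i (f n).1) (f n).1.
  by have [Gh Y0] := fP n; exact: pisom_energy pG (opa i) P0 Gh Y0.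
have Yle n : B (Y n) (Y n) <= B u u.
  have [Gh Y0] := fP n; rewrite (pisom_energy pG (pisom_op_id G) P0 Gh Y0) lerDl.
  by rewrite -cE -expr2 mulr_ge0// sqr_ge0.
(* The moments of Y_n are bounded because |Y_n| <= |u|, so they all converge along an
   ultrafilter. *)
have [F [FU oF]] := ultraFilterLemma (eventually_filter).
have /choice [l Hl] : forall i, exists l : R, (fun n => B (a i (Y n)) (Y n)) @ F --> l.
  move=> i; have [C HC] := op_bounded (opa i).
  apply: (@ultra_bounded_cvg _ _ _ _ ((`|C| + 1) * B u u)) => n.
  apply: (@le_trans _ _ ((`|C| + 1) * B (Y n) (Y n))); last first.
    by apply: ler_wpM2l => //; rewrite addr_ge0.
  have := B_ge0 (a i (Y n) - Y n); have := B_ge0 (a i (Y n) + Y n).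
  have := HC (Y n); have := ler_wpM2r (B_ge0 (Y n)) (ler_norm C).
  have := B_ge0 (Y n); move: (Y n) => z; move: (a i z) => w.
  by rewrite !BE (BC z w) ler_norml; form_lra.
have e8 : 0 < e / 8 by lra.
pose S := [set n | forall i, i \in ts -> `|l i - B (a i (Y n)) (Y n)| < e / 8].
have FS : F S.
  apply: (@filter_forall_mem _ F _ (fun i n => `|l i - B (a i (Y n)) (Y n)| < e / 8)).
  by move=> i _; have /cvgrPdist_lt/(_ _ e8) := Hl i.
(* [N] is fixed first. Then [n] is chosen so that X_n is almost orthogonal to the images of [t0] and
   Y_N under the operators and their adjoints, and to the targets in [L]. *)
have [N SN] := filter_ex FS.
have FXa (U : eqType) (z : U -> V) (q : seq U) :
    F [set n | forall w, w \in q -> `|B (X n) (z w)| < e / 8].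
  apply: (@filter_forall_mem _ F _ (fun w n => `|B (X n) (z w)| < e / 8)).
  by move=> w _; apply/oF/X_null.
have [n [[[[[Sn X1] X2] X3] X4] X5]] := filter_ex (filterI (filterI (filterI
  (filterI (filterI FS (FXa _ (fun i => a i t0) ts)) (FXa _ (fun i => a' i t0) ts))
  (FXa _ (fun i => a i (Y N)) ts)) (FXa _ (fun i => a' i (Y N)) ts))
  (FXa _ snd L)).
(* Each moment is off by six errors below e / 8: four cross terms with X_n, and two from comparing
   Y_N with Y_n through the limit [l]. *)
exists (t0 + Y N + X n); split => [i its|p pL].
- have [adj st st' _] := opa i.
  have aD x y z : B (a i (x + y)) z = B (a i x) z + B (a i y) z by rewrite !adj BDl.
  have aZ q x z : B (a i (q *: x)) z = q * B (a i x) z by rewrite !adj BZl.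
  have XX : B (a i (X n)) (X n) = (1 - r n ^+ 2) * B (a i (f n).1) (f n).1.
    by rewrite /X aZ BZr mulrA cE.
  have := energy i n; rewrite -XX; have := SN i its; have := Sn i its.
  have := X1 i its; have := X2 i its; have := X3 i its; have := X4 i its.
  have Gas := st _ _ G0; have Gas' := st' _ _ G0.
  rewrite /= -!adj !(BC (X n)).
  move: (X n) (Y N) (YG N) {XX} => x Z ZG.
  rewrite !aD !BDr (BC (a i t0) Z) (ZG _ _ Gas) (adj Z t0) (ZG _ _ Gas').
  rewrite (BC (a i s0) u) (P0 _ _ Gas) (adj u s0) (P0 _ _ Gas').
  rewrite (pisomE pG Gas G0).
  rewrite !ltr_norml; form_lra.
- have := X5 p pL; move: (X n) (Y N) (YG N) => x Z ZG /=.
  rewrite !BDl (ZG _ _ (GL _ pL)) (P0 _ _ (GL _ pL)).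
  rewrite (pisomE pG G0 (GL _ pL)) !ltr_norml; form_lra.
Qed.

(** The extension is applied to (1 - q) y with accuracy e' <= q on the norm as well, so that B x x <
    (1 - q)^2 + q < 1. The strict inequality later puts the coordinates of a net in the unit ball on
    a set of the ultrafilter. *)
Lemma pisom_extension_ball G (T : eqType) (a a' : T -> V -> V) (ts : seq T)
    (L : seq (V * V)) y (e : R) :
  partial_isometry G -> (forall i, pisom_op G (a i) (a' i)) ->
  (forall p, p \in L -> G p.1 p.2) -> B y y <= 1 -> 0 < e ->
  exists x, [/\ B x x < 1,
    forall i, i \in ts -> `|B (a i x) x - B (a i y) y| < e &
    forall p, p \in L -> `|B x p.2 - B y p.1| < e].
Proof.
move=> pG opa GL y1 e0.
pose K := \sum_(i <- ts) `|B (a i y) y| + \sum_(p <- L) `|B y p.1|.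
have K0 : 0 <= K by rewrite addr_ge0// sumr_ge0.
have K1 i : i \in ts -> `|B (a i y) y| <= K.
  move=> its; rewrite /K (big_rem i)//= -addrA lerDl.
  by rewrite addr_ge0// sumr_ge0.
have K2 p : p \in L -> `|B y p.1| <= K.
  move=> pL; rewrite /K [X in _ <= _ + X](big_rem p)//= addrCA lerDl.
  by rewrite addr_ge0// sumr_ge0.
(* [K] bounds the finitely many quantities to be approximated, and q K <= e / 4 keeps the effect of
   the scaling at most e / 2. *)
pose q := e / (4 * K + 4 + e).
have D0 : 0 < 4 * K + 4 + e by lra.
have q0 : 0 < q by exact: divr_gt0.
have q1 : q < 1 by rewrite ltr_pdivrMr//; lra.
have qK : q * K <= e / 4 by rewrite /q mulrAC ler_pdivrMr//; nra.
clearbody q.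
have near1 s : `|s| <= K -> `|(1 - q) * s - s| <= e / 4.
  move=> sK; have -> : (1 - q) * s - s = - (q * s) by ring.
  by rewrite normrN normrM gtr0_norm// (le_trans _ qK)// ler_wpM2l// ltW.
have near2 s : `|s| <= K -> `|(1 - q) * ((1 - q) * s) - s| <= e / 2.
  move=> sK; have -> : (1 - q) * ((1 - q) * s) - s = - ((2 - q) * (q * s)) by ring.
  rewrite normrN !normrM (gtr0_norm q0) gtr0_norm; last by lra.
  have qs : q * `|s| <= e / 4 by rewrite (le_trans _ qK)// ler_wpM2l// ltW.
  have : 0 <= q * (q * `|s|) by rewrite !mulr_ge0// ltW.
  by move=> *; lra.
pose e' := Num.min (e / 2) q.
have e'0 : 0 < e' by rewrite lt_min; apply/andP; split; lra.
have e'e : e' <= e / 2 by rewrite ge_min lexx.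
have e'q : e' <= q by rewrite ge_min lexx orbT.
(* [None] stands for the identity, which puts B x x among the controlled moments. *)
pose b (o : option T) := if o is Some i then a i else id.
pose b' (o : option T) := if o is Some i then a' i else id.
have opb o : pisom_op G (b o) (b' o) by case: o => [i|] /=; [|exact: pisom_op_id].
have [x [x1 x2]] := @pisom_extension G _ b b' (None :: map Some ts) L ((1 - q) *: y)
  e' pG opb GL e'0.
exists x; split.
- have := x1 None (mem_head _ _); rewrite /= BZl BZr ltr_norml => /andP[_].
  have := B_ge0 y; move: e'q y1; move: (B x x) (B y y) => p s hq s1 s0.
  have : 0 <= (1 - q) * (1 - q) * (1 - s) by rewrite !mulr_ge0//; lra.
  by move=> *; nra.
- move=> i its; have [adj _ _ _] := opa i.
  have aZ k z : B (a i (k *: y)) z = k * B (a i y) z by rewrite !adj BZl.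
  have := x1 (Some i); rewrite inE /= mem_map ?its; last by move=> ? ? [].
  move=> /(_ isT); rewrite aZ BZr !ltr_norml => /andP[].
  have := K1 i its; rewrite ler_norml => /andP[].
  move: (B _ x) (B _ y) => p s s1 s2.
  have := near2 s; rewrite !ler_norml s1 s2 => /(_ isT)/andP[] *.
  by apply/andP; split; lra.
- move=> p pL; have := x2 p pL; rewrite BZl !ltr_norml => /andP[].
  have := K2 p pL; rewrite ler_norml => /andP[].
  move: (B x _) (B y _) => p' s s1 s2.
  have := near1 s; rewrite !ler_norml s1 s2 => /(_ isT)/andP[] *.
  by apply/andP; split; lra.
Qed.

(** * Closing up an isometric relation *)

Definition semi_closure (G : V -> V -> Prop) x x' := forall e : R, 0 < e ->
  exists g g', [/\ G g g', B (g - x) (g - x) < e & B (g' - x') (g' - x') < e].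

Lemma semi_norm_dist x y z :
  B (x - z) (x - z) <= 2 * B (x - y) (x - y) + 2 * B (y - z) (y - z).
Proof.
have -> : x - z = (x - y) + (y - z) by rewrite addrA subrK.
move: (x - y) (y - z) => u w; have := B_ge0 (u - w); rewrite !BE (BC w u); form_lra.
Qed.

Lemma semi_norm_add x y z w :
  B (x + y - (z + w)) (x + y - (z + w)) <=
  2 * B (x - z) (x - z) + 2 * B (y - w) (y - w).
Proof.
have := semi_norm_dist (x - z) 0 (w - y); rewrite subr0 sub0r opprB.
by have -> : x + y - (z + w) = x - z + (y - w) by rewrite opprD addrACA.
Qed.

Lemma semi_cvg_form f g x y : semi_cvg f x -> semi_cvg g y ->
  (fun n => B (f n) (g n)) @ \oo --> B x y.
Proof.
move=> fx gy; apply/cvgrPdist_lt => e e0.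
have S0 : 0 < B x x + B y y + 1 by have := B_ge0 x; have := B_ge0 y; lra.
pose t := e / (2 * (B x x + B y y + 1)).
have t0 : 0 < t by apply: divr_gt0 => //; lra.
have tE : t * (B x x + B y y + 1) = e / 2 by rewrite /t; field; exact: lt0r_neq0.
have te0 : 0 < t * e by exact: mulr_gt0.
pose d := Num.min (e / 8) (t * e / 4).
have d0 : 0 < d by rewrite lt_min; apply/andP; split; lra.
have [N HN] := fx _ d0; have [N' HN'] := gy _ d0.
exists (maxn N N') => // n /= Nn.
have := HN n (leq_trans (leq_maxl _ _) Nn).
have := HN' n (leq_trans (leq_maxr _ _) Nn).
(* The mixed terms are estimated by Young's inequality with weight [t], the product of the two
   errors with weight 1. *)
have -> : B x y - B (f n) (g n) =
    - (B (f n - x) (g n - y) + B (f n - x) y + B (g n - y) x).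
  rewrite !BE (BC (g n) x) (BC y x); form_lra.
move: (f n - x) (g n - y) => u w wd ud.
have t1 : d / t <= e / 4.
  rewrite ler_pdivrMr//; apply: (@le_trans _ _ (t * e / 4)); last by lra.
  by rewrite ge_min lexx orbT.
have d8 : d <= e / 8 by rewrite ge_min lexx.
have ut : B u u / t <= e / 4.
  by apply: le_trans t1; apply: ler_wpM2r (ltW ud); rewrite invr_ge0 ltW.
have wt : B w w / t <= e / 4.
  by apply: le_trans t1; apply: ler_wpM2r (ltW wd); rewrite invr_ge0 ltW.
have := semi_inner_young u y t0; have := semi_inner_young w x t0.
have := semi_inner_young u w ltr01; rewrite divr1 mul1r normrN.
have := B_ge0 x; have := B_ge0 y.
have := ler_normD (B u w + B u y) (B w x); have := ler_normD (B u w) (B u y).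
move: tE ud wd ut wt; rewrite mulrDr mulrDr mulr1.
move: (`|_|) (`|_|) (`|_|) (`|_|) (`|_|) (B u u / t) (B w w / t).
move: (t * B x x) (t * B y y) (B u u) (B w w) => *; lra.
Qed.

Lemma semi_closure_pisom G : G 0 0 ->
  (forall x x' y y', G x x' -> G y y' -> G (x + y) (x' + y')) ->
  (forall k x x', G x x' -> G (k *: x) (k *: x')) ->
  (forall x x' y y', G x x' -> G y y' -> B x y = B x' y') ->
  partial_isometry (semi_closure G).
Proof.
move=> G0 GD GZ GE.
have seqP x x' : semi_closure G x x' -> exists f f',
    [/\ forall n, G (f n) (f' n), semi_cvg f x & semi_cvg f' x'].
  have [v [v01 v_small]] := vanishing_seq R.
  move=> xx'; have /choice [f fP] : forall n, exists p : V * V,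
      [/\ G p.1 p.2, B (p.1 - x) (p.1 - x) < v n & B (p.2 - x') (p.2 - x') < v n].
    move=> n; have /andP[/xx' [g [g' [? ? ?]]] _] := v01 n.
    by exists (g, g').
  exists (fun n => (f n).1), (fun n => (f n).2); split.
  - by move=> n; case: (fP n).
  - move=> e /v_small[N HN]; exists N => n /HN vn.
    by have [_ /lt_trans + _] := fP n; exact.
  - move=> e /v_small[N HN]; exists N => n /HN vn.
    by have [_ _ /lt_trans] := fP n; exact.
split.
- by move=> e e0; exists 0, 0; rewrite !subr0 B0l.
- move=> x x' y y' Gx Gy e e0; have e4 : 0 < e / 4 by lra.
  have [g [g' [Gg gx gx']]] := Gx _ e4; have [k [k' [Gk ky ky']]] := Gy _ e4.
  exists (g + k), (g' + k'); split; first exact: GD.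
  + have := semi_norm_add g k x y; lra.
  + have := semi_norm_add g' k' x' y'; lra.
- move=> k x x' Gx e e0.
  have k0 : 0 < k ^+ 2 + 1 by have := sqr_ge0 k; lra.
  have [g [g' [Gg gx gx']]] := Gx _ (divr_gt0 e0 k0).
  exists (k *: g), (k *: g'); split; first exact: GZ.
  + move: gx; rewrite -scalerBr BZl BZr mulrA -expr2 ltr_pdivlMr//.
    by have := B_ge0 (g - x); nra.
  + move: gx'; rewrite -scalerBr BZl BZr mulrA -expr2 ltr_pdivlMr//.
    by have := B_ge0 (g' - x'); nra.
- move=> x x' y y' /seqP[f [f' [Gf fx fx']]] /seqP[g [g' [Gg gy gy']]].
  have h1 := semi_cvg_form fx gy; have h2 := semi_cvg_form fx' gy'.
  have e : (fun n => B (f n) (g n)) = (fun n => B (f' n) (g' n)).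
    by apply/funext => n; exact: GE.
  by rewrite e in h1; rewrite -(cvg_lim (@Rhausdorff R) h1) -(cvg_lim (@Rhausdorff R) h2).
- move=> f f' x x' Gf fx fx' e e0; have e4 : 0 < e / 4 by lra.
  have [N HN] := fx _ e4; have [N' HN'] := fx' _ e4.
  have [g [g' [Gg gx gx']]] := Gf (maxn N N') _ e4.
  exists g, g'; split => //.
  + have := HN _ (leq_maxl N N'); have := semi_norm_dist g (f (maxn N N')) x; lra.
  + have := HN' _ (leq_maxr N N'); have := semi_norm_dist g' (f' (maxn N N')) x'; lra.
Qed.

Lemma semi_closure_stable G (a : V -> V) C :
  (forall x y, a (x - y) = a x - a y) ->
  (forall x, B (a x) (a x) <= C * B x x) ->
  (forall x x', G x x' -> G (a x) (a x')) ->
  forall x x', semi_closure G x x' -> semi_closure G (a x) (a x').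
Proof.
move=> aB aC Ga x x' Gx e e0.
have C0 : 0 < `|C| + 1 by have := normr_ge0 C; lra.
have [g [g' [Gg gx gx']]] := Gx _ (divr_gt0 e0 C0).
have small z : B z z < e / (`|C| + 1) -> B (a z) (a z) < e.
  rewrite ltr_pdivlMr// => ze; apply: le_lt_trans ze; apply: (le_trans (aC z)).
  rewrite mulrC; apply: ler_wpM2l => //; have := ler_norm C; lra.
by exists (a g), (a g'); rewrite -!aB; split; [exact: Ga | exact: small | exact: small].
Qed.

End SemiInner.

(** * Representations over the reals *)

Section RealInner.
Variables (R : realType) (H : hilbertType R).
Implicit Types x y z : H.

(** Makes [H] a real inner product space; multiplication by i recovers the imaginary part, see
    [im_inner]. *)
Definition re_inner (x y : H) : R := complex.Re ⟨x | y⟩.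

Lemma Re_conj (c : R[i]) : complex.Re (Num.conj c) = complex.Re c.
Proof. by case: c. Qed.

Lemma re_innerC x y : re_inner x y = re_inner y x.
Proof. rewrite /re_inner hermC expr0 mul1r; exact: Re_conj. Qed.

Lemma re_innerDl x y z : re_inner (x + y) z = re_inner x z + re_inner y z.
Proof. by rewrite /re_inner linearDl raddfD. Qed.

Lemma re_innerZl (k : R) x y : re_inner (k%:C *: x) y = k * re_inner x y.
Proof. by rewrite /re_inner linearZl_LR /=; case: ⟨x | y⟩ => a b; simpc. Qed.

Lemma re_inner_rnorm x : re_inner x x = rnorm x ^+ 2.
Proof.
by rewrite /re_inner -normE_inner -[`|x|]rnormE -rmorphXn.
Qed.

Lemma rnorm_ge0 x : 0 <= rnorm x.
Proof. by have := normr_ge0 x; rewrite -rnormE lecR. Qed.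

Lemma re_inner_ge0 x : 0 <= re_inner x x.
Proof. by rewrite re_inner_rnorm sqr_ge0. Qed.

Lemma norm_le1E x : (`|x| <= 1) = (re_inner x x <= 1).
Proof.
by rewrite -rnormE -(rmorph1 (real_complex R)) lecR re_inner_rnorm expr_le1// rnorm_ge0.
Qed.

Lemma im_inner x y : complex.Im ⟨x | y⟩ = - re_inner ('i *: x) y.
Proof. by rewrite /re_inner linearZl_LR /=; case: ⟨x | y⟩ => a b; simpc. Qed.

Lemma re_innerDr (x y z : H) : re_inner x (y + z) = re_inner x y + re_inner x z.
Proof. by rewrite re_innerC re_innerDl !(re_innerC x). Qed.

Lemma re_inner0l (y : H) : re_inner 0 y = 0.
Proof. by rewrite /re_inner linear0l raddf0. Qed.

Lemma re_innerNl (x y : H) : re_inner (- x) y = - re_inner x y.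
Proof. by rewrite /re_inner linearNl raddfN. Qed.

Lemma re_innerNr (x y : H) : re_inner x (- y) = - re_inner x y.
Proof. by rewrite re_innerC re_innerNl re_innerC. Qed.

Definition re_innerE := (re_innerDl, re_innerDr, re_innerNl, re_innerNr).

Lemma re_inner_subM (x y : H) :
  re_inner (x - y) (x - y) <= 2 * re_inner x x + 2 * re_inner y y.
Proof.
have := re_inner_ge0 (x + y); rewrite !re_innerE (re_innerC y x); lra.
Qed.

End RealInner.

Section Rep.
Variables (R : realType) (A : cstarAlgebraType R) (H : hilbertType R).
Variable pi : representation A H.

(** Every pi(a) annihilates pi(1) x - x, so non-degeneracy forces this vector to be 0. *)
Lemma rep_unit (pi_nd : nondegenerate_rep pi) (x : H) : pi cone x = x.
Proof.
apply/eqP; rewrite -subr_eq0; apply/negPn/negP => /pi_nd[a].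
by rewrite linearB -rep_mul cmula1 subrr eqxx.
Qed.

Lemma rep_scale (c : R[i]) (a : A) (x : H) : pi (c *: a) x = c *: pi a x.
Proof.
have := rep_linear pi c a 0 x; rewrite addr0.
(* This instance of linearity reads pi(0) x = 0. *)
have := rep_linear pi (-1) 0 0 x; rewrite scaler0 addr0 scaleN1r addNr => ->.
by move=> ->; rewrite addr0.
Qed.

Lemma rep_zero (x : H) : pi 0 x = 0.
Proof. by rewrite -(scale0r 0) rep_scale scale0r. Qed.

Lemma rep_adjoint (a : A) (x y : H) :
  re_inner (pi a x) y = re_inner x (pi (star a) y).
Proof. by rewrite re_innerC [RHS]re_innerC /re_inner rep_star. Qed.

Lemma unit_ball_scale (V : normedModType R[i]) (v : V) :
  exists (k : R) (b : unit_ball V), 0 < k /\ v = k%:C *: sval b.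
Proof.
have n0 : 0 <= rnorm v by have := normr_ge0 v; rewrite -rnormE lecR.
(* Adding 1 avoids a case distinction at v = 0. *)
have k0 : 0 < rnorm v + 1 by lra.
have vb : `|((rnorm v + 1)^-1)%:C *: v| <= 1.
  rewrite normrZ -(rnormE v) ger0_norm ?lecR ?invr_ge0 ?(ltW k0)// -rmorphM.
  rewrite -(rmorph1 (real_complex R)) lecR ler_pdivrMl// mulr1; lra.
exists (rnorm v + 1), (exist (fun v : V => is_true (`|v| <= 1)) _ vb); split => //=.
by rewrite scalerA -rmorphM divff ?rmorph1 ?scale1r// lt0r_neq0.
Qed.

Lemma rep_bounded (a : A) : exists C : R, forall x,
  re_inner (pi a x) (pi a x) <= C * re_inner x x.
Proof.
have [k [b [k0 ->]]] := unit_ball_scale a.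
exists (k ^+ 2) => x; rewrite rep_scale re_innerZl re_innerC re_innerZl mulrA -expr2.
apply: ler_wpM2l; first exact: sqr_ge0.
have [->|x0] := eqVneq x 0; first by rewrite linear0.
have n0 : 0 < rnorm x.
  by rewrite -ltcR rnormE normr_gt0.
have xn : `|x| <= (rnorm x)%:C by rewrite rnormE.
have xE : x = (rnorm x)%:C *: ((rnorm x)^-1%:C *: x).
  by rewrite scalerA -rmorphM divff ?rmorph1 ?scale1r// lt0r_neq0.
rewrite [in X in X <= _]xE linearZ_LR re_innerZl re_innerC re_innerZl mulrA -expr2.
rewrite [leRHS]re_inner_rnorm -[leRHS]mulr1; apply: ler_wpM2l; first exact: sqr_ge0.
rewrite -norm_le1E.
exact: (ball_dot_proof pi b
  (exist (fun v : H => is_true (`|v| <= 1)) _ (rescale_proof n0 xn))).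
Qed.
End Rep.

(** * Ultrapowers *)

Section BoundedNets.
Variables (R : realType) (H : hilbertType R) (I : Type).

Definition bounded_net : {pred I -> H} :=
  fun f => `[< exists M : R, forall i, re_inner (f i) (f i) <= M >].

Lemma bounded_netP f :
  reflect (exists M : R, forall i, re_inner (f i) (f i) <= M)
    (f \in bounded_net).
Proof. exact: asboolP. Qed.

Lemma bounded_net_zmod : zmod_closed bounded_net.
Proof.
split=> [|f g /bounded_netP[M fM] /bounded_netP[N gN]]; apply/bounded_netP.
  by exists (re_inner 0 (0 : H)).
exists (2 * M + 2 * N) => i; apply: (le_trans (re_inner_subM _ _)).
by have := fM i; have := gN i; lra.
Qed.

HB.instance Definition _ :=
  GRing.isZmodClosed.Build (I -> H) bounded_net bounded_net_zmod.

(** Null nets are not divided out: the limit form is only semi-definite, which the section on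
    semi-inner products allows. *)
Record bnet := BNet { bnet_fun :> I -> H; bnetP : bnet_fun \in bounded_net }.

HB.instance Definition _ := [isSub for bnet_fun].
HB.instance Definition _ := [Choice of bnet by <:].
HB.instance Definition _ := [SubChoice_isSubZmodule of bnet by <:].

Lemma bounded_net_scale (k : R) (x : bnet) :
  (fun i => k%:C *: x i) \in bounded_net.
Proof.
have /bounded_netP[M xM] := bnetP x; apply/bounded_netP; exists (k ^+ 2 * M) => i.
by rewrite re_innerZl re_innerC re_innerZl mulrA -expr2 ler_wpM2l ?sqr_ge0.
Qed.

Definition bnet_scale k x : bnet := BNet (bounded_net_scale k x).

Lemma bnet_ext (x y : bnet) : (forall i, x i = y i) -> x = y.
Proof. by move=> xy; apply/val_inj/funext. Qed.

Fact bnet_scaleA a b x : bnet_scale a (bnet_scale b x) = bnet_scale (a * b) x.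
Proof. by apply: bnet_ext => i /=; rewrite scalerA rmorphM. Qed.
Fact bnet_scale1 : left_id 1 bnet_scale.
Proof. by move=> x; apply: bnet_ext => i /=; rewrite rmorph1 scale1r. Qed.
Fact bnet_scaleDr : right_distributive bnet_scale +%R.
Proof. by move=> k x y; apply: bnet_ext => i; exact: scalerDr. Qed.
Fact bnet_scaleDl x : {morph bnet_scale^~ x : a b / a + b}.
Proof. by move=> a b; apply: bnet_ext => i /=; rewrite rmorphD; exact: scalerDl. Qed.

HB.instance Definition _ := GRing.Zmodule_isLmodule.Build R bnet
  bnet_scaleA bnet_scale1 bnet_scaleDr bnet_scaleDl.

Variables (F : set_system I) (FU : UltraFilter F).

Lemma re_inner_bnet_bounded (x y : bnet) : exists M : R,
  forall i, `|re_inner (x i) (y i)| <= M.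
Proof.
have /bounded_netP[M xM] := bnetP x; have /bounded_netP[N yN] := bnetP y.
exists (M + N) => i; have := xM i; have := yN i.
have := re_inner_ge0 (x i - y i); have := re_inner_ge0 (x i + y i).
have := re_inner_ge0 (x i); have := re_inner_ge0 (y i).
rewrite !re_innerE (re_innerC (y i) (x i)) ler_norml => *.
by apply/andP; split; lra.
Qed.

Definition lim_inner (x y : bnet) : R :=
  lim ((fun i => re_inner (x i) (y i)) @ F).

Lemma lim_inner_cvg (x y : bnet) :
  (fun i => re_inner (x i) (y i)) @ F --> lim_inner x y.
Proof.
have [M xyM] := re_inner_bnet_bounded x y.
have [l Hl] := ultra_bounded_cvg FU xyM.
have PF : ProperFilter F by exact: ultra_proper.
by rewrite /lim_inner (cvg_lim (@Rhausdorff R) Hl).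
Qed.

Let lim_innerE (x y : bnet) l :
  (fun i => re_inner (x i) (y i)) @ F --> l -> lim_inner x y = l.
Proof.
have PF : ProperFilter F by exact: ultra_proper.
exact: (cvg_lim (@Rhausdorff R)).
Qed.

Lemma lim_innerC x y : lim_inner x y = lim_inner y x.
Proof.
apply: lim_innerE; have := @lim_inner_cvg y x.
by under eq_fun do rewrite re_innerC.
Qed.

Lemma lim_innerDl x y z : lim_inner (x + y) z = lim_inner x z + lim_inner y z.
Proof.
have PF : ProperFilter F by exact: ultra_proper.
apply: lim_innerE.
rewrite (_ : (fun i => _) =
  (fun i => re_inner (x i) (z i)) \+ (fun i => re_inner (y i) (z i))).
  exact: (cvgD (@lim_inner_cvg x z) (@lim_inner_cvg y z)).
by apply/funext => i; exact: re_innerDl.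
Qed.

Lemma lim_innerZl k x y : lim_inner (k *: x) y = k * lim_inner x y.
Proof.
have PF : ProperFilter F by exact: ultra_proper.
apply: lim_innerE.
rewrite (_ : (fun i => _) = (fun i => k * re_inner (x i) (y i))).
  exact: (cvgMl_tmp (@lim_inner_cvg x y)).
by apply/funext => i; exact: re_innerZl.
Qed.

Lemma lim_inner_near (x y : bnet) (e : R) : 0 < e ->
  F [set i | `|lim_inner x y - re_inner (x i) (y i)| < e].
Proof. by move=> e0; have /cvgrPdist_lt/(_ _ e0) := @lim_inner_cvg x y. Qed.

Lemma lim_inner_le (x y z w : bnet) (c : R) :
  F [set i | re_inner (x i) (y i) <= c * re_inner (z i) (w i)] ->
  lim_inner x y <= c * lim_inner z w.
Proof.
have PF : ProperFilter F by exact: ultra_proper.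
move=> le; apply/ler_addgt0Pl => e e0.
have c0 : 0 < `|c| + 1 by rewrite ltr_wpDl.
have e2 : 0 < e / 2 by lra.
have e3 : 0 < e / 2 / (`|c| + 1) by rewrite divr_gt0.
have [i [[/= h1 h2] h3]] := filter_ex (filterI (filterI le
  (lim_inner_near x y e2)) (lim_inner_near z w e3)).
have h4 : `|c * (lim_inner z w - re_inner (z i) (w i))| <= e / 2.
  rewrite normrM; have := ltW h3; rewrite ler_pdivlMr// mulrC => h.
  by apply: le_trans h; rewrite ler_wpM2r// lerDl.
by move: h1 h2 h4; rewrite !ltr_norml !ler_norml mulrBr => h1 /andP[] ? ? /andP[] ? ?; lra.
Qed.

Lemma lim_inner_ge0 x : 0 <= lim_inner x x.
Proof.
have PF : ProperFilter F by exact: ultra_proper.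
rewrite leNgt; apply/negP; rewrite -oppr_gt0 => /(lim_inner_near x x)/filter_ex[i /=].
by have := re_inner_ge0 (x i); rewrite ltr_norml => ? /andP[] *; lra.
Qed.

(* Countable incompleteness of [F] allows a diagonal argument in each coordinate,
   so the completeness of [H] plays no role. *)
Variable N : I -> nat.
Hypothesis N_oo : forall k, F [set i | (k <= N i)%N].

Lemma lim_inner_complete (x : nat -> bnet) : semi_cauchy lim_inner x ->
  exists y, semi_cvg lim_inner x y.
Proof.
have PF : ProperFilter F by exact: ultra_proper.
move=> xC; have [v [v01 v_small]] := vanishing_seq R.
have v0 j : 0 < v j by case/andP: (v01 j).
have /choice[f fP] : forall j, exists n, forall m p, (n <= m)%N -> (n <= p)%N ->
    lim_inner (x m - x p) (x m - x p) < v j by move=> j; exact: xC.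
(* Beyond all of f 0, ..., f j, so the subsequence x (g l) stays within [v j] of its term [j] in
   squared norm for l >= j. *)
pose g j := (\max_(l < j.+1) f l)%N.
have fg j l : (j <= l)%N -> (f j <= g l)%N.
  by move=> jl; exact: (leq_bigmax (Ordinal (jl : (j < l.+1)%N))).
pose sq (j l : nat) i := re_inner (x (g j) i - x (g l) i) (x (g j) i - x (g l) i).
(* At coordinate [i] the terms up to [k] already satisfy the Cauchy estimates that hold in the
   limit. *)
pose good i k := forall j l, (j <= l)%N -> (l <= k)%N -> sq j l i < v j.
have goodF k : F [set i | good i k].
  have H1 j : F [set i | forall l, l \in iota 0 k.+1 -> (j <= l)%N -> sq j l i < v j].
    apply: (@filter_forall_mem _ F _ (fun l i => (j <= l)%N -> sq j l i < v j)) => l _.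
    have [jl|jl] := leqP j l; last by apply: filterE => i.
    have e0 : 0 < v j - lim_inner (x (g j) - x (g l)) (x (g j) - x (g l)).
      by rewrite subr_gt0; apply: fP; exact: fg.
    apply: filterS (lim_inner_near _ _ e0) => i /= h _.
    have {h} : `|lim_inner (x (g j) - x (g l)) (x (g j) - x (g l)) - sq j l i| <
      v j - lim_inner (x (g j) - x (g l)) (x (g j) - x (g l)) := h.
    by rewrite ltr_norml => /andP[+ _]; lra.
  have H2 : F [set i | forall j, j \in iota 0 k.+1 -> forall l, l \in iota 0 k.+1 ->
      (j <= l)%N -> sq j l i < v j].
    apply: (@filter_forall_mem _ F _ (fun j i => forall l, l \in iota 0 k.+1 ->
      (j <= l)%N -> sq j l i < v j)) => j _; exact: H1.
  apply: filterS H2 => i Hi j l jl lk.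
  by apply: (Hi j _ l _ jl); rewrite mem_iota leq0n add0n ltnS// (leq_trans jl).
have good0 i : good i 0%N.
  move=> j l jl; rewrite leqn0 => /eqP l0; move: jl; rewrite l0 leqn0 => /eqP ->.
  by rewrite /sq subrr re_inner0l.
(* The greatest good index up to [N i]: the cap makes it exist, and by [goodF] and [N_oo] it reaches
   any given [j] on a set of [F]. *)
have /choice[k kP] : forall i, exists k, good i k /\
    forall l, (l <= N i)%N -> good i l -> (l <= k)%N.
  move=> i; have ex : exists k, (k <= N i)%N && `[< good i k >].
    by exists 0%N; apply/asboolP.
  have bnd l : (l <= N i)%N && `[< good i l >] -> (l <= N i)%N by case/andP.
  have [k /andP[_ /asboolP gk] kmax] := ex_maxnP ex bnd; exists k; split=> // l lN gl.
  by apply: kmax; rewrite lN; apply/asboolP.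
have yB : (fun i => x (g (k i)) i) \in bounded_net.
  have /bounded_netP[M xM] := bnetP (x (g 0%N)); apply/bounded_netP.
  exists (2 * M + 2 * v 0%N) => i; have [gk _] := kP i.
  have -> : x (g (k i)) i = x (g 0%N) i - (x (g 0%N) i - x (g (k i)) i).
    by rewrite opprB addrC subrK.
  apply: (le_trans (re_inner_subM _ _)); have := xM i.
  have := gk 0%N (k i) (leq0n _) (leqnn _); rewrite /sq; lra.
exists (BNet yB) => e e0; have e4 : 0 < e / 4 by lra.
have [j Hj] := v_small _ e4; have vj := Hj j (leqnn j).
have lim_j : lim_inner (x (g j) - BNet yB) (x (g j) - BNet yB) <= v j.
  rewrite leNgt; apply/negP; rewrite -subr_gt0 => d0.
  have [i [[/= h1 h2] h3]] := filter_ex (filterI (filterI (lim_inner_near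
    (x (g j) - BNet yB) (x (g j) - BNet yB) d0) (goodF j)) (N_oo j)).
  have [gk kmax] := kP i; have := gk j (k i) (kmax j h3 h2) (leqnn _).
  have {h1} : `|lim_inner (x (g j) - BNet yB) (x (g j) - BNet yB) - sq j (k i) i| <
    lim_inner (x (g j) - BNet yB) (x (g j) - BNet yB) - v j := h1.
  by rewrite ltr_norml => /andP[_]; lra.
exists (g j) => n gn.
have := @semi_norm_dist _ _ lim_inner lim_innerC lim_innerDl lim_innerZl lim_inner_ge0
  (x n) (x (g j)) (BNet yB).
have := fP j n (g j) (leq_trans (fg _ _ (leqnn _)) gn) (fg _ _ (leqnn _)).
by move=> *; lra.
Qed.

End BoundedNets.

(** * The module map between two tuples of nets *)

Section NetRepresentation.
Variables (R : realType) (A : cstarAlgebraType R) (H : hilbertType R).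
Variables (pi : representation A H) (pi_nd : nondegenerate_rep pi).

Section NetOperators.
Variable I : Type.

Lemma bounded_net_rep (a : A) (x : bnet H I) :
  (fun i => pi a (x i)) \in @bounded_net R H I.
Proof.
have [C HC] := rep_bounded pi a; have /bounded_netP[M xM] := bnetP x.
apply/bounded_netP; exists (`|C| * M) => i; apply: (le_trans (HC _)).
apply: (le_trans (ler_wpM2r (re_inner_ge0 _) (ler_norm C))).
by apply: ler_wpM2l.
Qed.

Definition bnet_rep a x : bnet H I := BNet (bounded_net_rep a x).

Variables (F : set_system I) (FU : UltraFilter F).
Let B := @lim_inner R H I F.

Lemma bnet_rep_adj a x y : B (bnet_rep a x) y = B x (bnet_rep (star a) y).
Proof.
rewrite /B /lim_inner; congr (lim (_ @ F)).
by apply/funext => i; rewrite /= rep_adjoint.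
Qed.

Lemma bnet_repB a x y : bnet_rep a (x - y) = bnet_rep a x - bnet_rep a y.
Proof. by apply: bnet_ext => i; exact: linearB. Qed.

Lemma bnet_rep_bounded a : exists C, forall x,
  B (bnet_rep a x) (bnet_rep a x) <= C * B x x.
Proof.
have PF : ProperFilter F by exact: ultra_proper.
have [C HC] := rep_bounded pi a; exists C => x; apply: lim_inner_le => //.
by apply: filterE => i; exact: HC.
Qed.

(** The submodule generated by the pairs (s_j, t_j). Zero and real multiples arise from the
    operators of 0 and of multiples of the unit. *)
Inductive intertwined (s t : nat -> bnet H I) : bnet H I -> bnet H I -> Prop :=
| intertwined_gen j : intertwined s t (s j) (t j)
| intertwined_add x x' y y' : intertwined s t x x' -> intertwined s t y y' ->
    intertwined s t (x + y) (x' + y')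
| intertwined_rep a x x' : intertwined s t x x' ->
    intertwined s t (bnet_rep a x) (bnet_rep a x').

Lemma bnet_rep_unit x : bnet_rep cone x = x.
Proof. by apply: bnet_ext => i /=; rewrite rep_unit. Qed.

Lemma bnet_rep_mul a b x : bnet_rep a (bnet_rep b x) = bnet_rep (cmul a b) x.
Proof. by apply: bnet_ext => i /=; rewrite rep_mul. Qed.

Lemma bnet_repD a x y : bnet_rep a (x + y) = bnet_rep a x + bnet_rep a y.
Proof. by apply: bnet_ext => i; exact: linearD. Qed.

Variables s t : nat -> bnet H I.
Hypothesis st : forall a i j,
  B (bnet_rep a (s i)) (s j) = B (bnet_rep a (t i)) (t j).

Let BC x y : B x y = B y x.
Proof. exact: lim_innerC. Qed.

Let BDl x y z : B (x + y) z = B x z + B y z.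
Proof. exact: lim_innerDl. Qed.

Lemma intertwined_isometric x x' y y' :
  intertwined s t x x' -> intertwined s t y y' -> B x y = B x' y'.
Proof.
have base z z' : intertwined s t z z' -> forall a j,
    B (bnet_rep a z) (s j) = B (bnet_rep a z') (t j).
  elim=> {z z'} [i|z z' w w' _ IH1 _ IH2|b z z' _ IH] a j; first exact: st.
    by rewrite !bnet_repD !BDl IH1 IH2.
  by rewrite !bnet_rep_mul.
(* Inserting the unit and generalizing it gives an induction hypothesis for all operators; those on
   the right are moved to the left by adjunction. *)
move=> xx'; rewrite -(bnet_rep_unit x) -(bnet_rep_unit x').
move=> yy'; move: cone; elim: yy' => {y y'} [j|z z' w w' _ IH1 _ IH2|b z z' _ IH] a.
- exact: base.
- by rewrite BC BDl !(BC _ (bnet_rep a x)) IH1 IH2 [RHS]BC BDl !(BC _ (bnet_rep a x')).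
- have h u v : B u (bnet_rep b v) = B (bnet_rep (star b) u) v.
    by rewrite bnet_rep_adj starK.
  by rewrite !h !bnet_rep_mul.
Qed.

Lemma intertwined_pisom : partial_isometry B (semi_closure B (intertwined s t)).
Proof.
apply: semi_closure_pisom; [exact: lim_innerC | exact: lim_innerDl |
  exact: lim_innerZl | exact: lim_inner_ge0 | | | | ].
- have := intertwined_rep 0 (intertwined_gen s t 0).
  have z x : bnet_rep 0 x = 0 by apply: bnet_ext => i /=; rewrite rep_zero.
  by rewrite !z.
- by move=> *; exact: intertwined_add.
- move=> k x x' /(intertwined_rep (k%:C *: cone)).
  have z w : bnet_rep (k%:C *: cone) w = k *: w.
    by apply: bnet_ext => i /=; rewrite rep_scale rep_unit.
  by rewrite !z.
- exact: intertwined_isometric.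
Qed.

Lemma intertwined_op a :
  pisom_op B (semi_closure B (intertwined s t))
    (bnet_rep a) (bnet_rep (star a)).
Proof.
have stable b x x' : semi_closure B (intertwined s t) x x' ->
    semi_closure B (intertwined s t) (bnet_rep b x) (bnet_rep b x').
  have [C HC] := bnet_rep_bounded b.
  apply: (semi_closure_stable (lim_inner_ge0 FU)) => //; first exact: bnet_repB.
  by move=> z z'; exact: intertwined_rep.
split; [exact: bnet_rep_adj | exact: stable | exact: stable | exact: bnet_rep_bounded].
Qed.

End NetOperators.

End NetRepresentation.

(** * One-point extensions, uniformly in the moments *)

Section UniformExtension.
Variables (R : realType) (A : cstarAlgebraType R) (H : hilbertType R).
Variables (pi : representation A H) (pi_nd : nondegenerate_rep pi).
Implicit Types rho : nat -> unit_ball H.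

Definition moment rho (a : A) i j :=
  re_inner (pi a (sval (rho i))) (sval (rho j)).

Definition moments_close (e : R) n (s : seq A) rho rho' :=
  forall a i j, a \in s -> (i < n)%N -> (j < n)%N ->
    `|moment rho a i j - moment rho' a i j| < e.

(** The tail filter of pairs ordered by size and inclusion: along it each given coefficient and
    variable is eventually included. *)
Definition moment_filter : set_system (nat * seq A) :=
  [set S : set (nat * seq A) | exists n0 (s0 : seq A), forall n (s : seq A),
    (n0 <= n)%N -> {subset s0 <= s} -> S (n, s)].

Lemma moment_filter_proper : ProperFilter moment_filter.
Proof.
split; first by move=> [n [s h]]; exact: (h n s (leqnn n)).
split.
- by exists 0%N, [::].
- move=> P Q [n [s Ps]] [m [t Qt]]; exists (maxn n m), (s ++ t) => k u.
  rewrite geq_max => /andP[nk mk] su; split; [apply: Ps|apply: Qt] => // a au;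
    by apply: su; rewrite mem_cat au ?orbT.
- by move=> P Q PQ [n [s Ps]]; exists n, s => k u nk su; apply/PQ/Ps.
Qed.

Lemma bounded_net_ball I (x : I -> unit_ball H) :
  (fun i => sval (x i)) \in @bounded_net R H I.
Proof.
apply/bounded_netP; exists 1 => i; rewrite -norm_le1E; exact: svalP (x i).
Qed.

(* The ultrapower is taken along counterexamples [P i] to ever finer instances
   [i] of the statement. *)
Lemma uniform_extension k n (s : seq A) (e : R) : 0 < e -> exists d m u,
  0 < d /\ forall rho rho', moments_close d m u rho rho' ->
  forall x, exists x', moments_close e n s (update rho k x) (update rho' k x').
Proof.
move=> e0; apply: contrapT => no.
have /choice[P PP] : forall i : nat * seq A,
    exists p : (nat -> unit_ball H) * (nat -> unit_ball H) * unit_ball H,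
    moments_close i.1.+1%:R^-1 i.1 i.2 p.1.1 p.1.2 /\
    forall x', ~ moments_close e n s (update p.1.1 k p.2) (update p.1.2 k x').
  move=> i; apply: contrapT => no'; apply: no.
  exists i.1.+1%:R^-1, i.1, i.2; split; first by rewrite invr_gt0.
  move=> rho rho' rr x; apply: contrapT => no''; apply: no'.
  by exists (rho, rho', x); split => //= x' cl; apply: no''; exists x'.
have [F [FU momF]] := ultraFilterLemma moment_filter_proper.
have PF : ProperFilter F by exact: ultra_proper.
pose B := @lim_inner R H (nat * seq A) F.
pose S j : bnet H _ := BNet (bounded_net_ball (fun i => (P i).1.1 j)).
pose T j : bnet H _ := BNet (bounded_net_ball (fun i => (P i).1.2 j)).
pose y : bnet H _ := BNet (bounded_net_ball (fun i => (P i).2)).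
have ST a i j : B (bnet_rep pi a (S i)) (S j) = B (bnet_rep pi a (T i)) (T j).
  apply/eqP; rewrite -subr_eq0 -normr_le0; apply/ler_addgt0Pl => d d0.
  have d3 : 0 < d / 3 by lra.
  have [N _ HN] := near_infty_natSinv_lt (PosNum d3).
  have FM : F [set l | `|moment (P l).1.1 a i j - moment (P l).1.2 a i j| < d / 3].
    apply: momF; exists (maxn N (maxn i.+1 j.+1)), [:: a] => m u.
    rewrite !geq_max => /and3P[Nm im jm] au; have [/= cl _] := PP (m, u).
    by apply: lt_trans (HN _ Nm); apply: cl => //; apply: au; rewrite mem_head.
  have [l [[/= h1 h2] h3]] := filter_ex (filterI (filterI FM
    (lim_inner_near FU (bnet_rep pi a (S i)) (S j) d3))
    (lim_inner_near FU (bnet_rep pi a (T i)) (T j) d3)).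
  move: h1 h2 h3; rewrite -/(moment (P l).1.1 a i j) -/(moment (P l).1.2 a i j).
  rewrite -/(B _ _) -/(B _ _) addr0.
  move: (moment _ _ _ _) (moment _ _ _ _) (B _ _) (B _ _) => p q v w.
  rewrite !ltr_norml ler_norml => /andP[? ?] /andP[? ?] /andP[? ?].
  by apply/andP; split; lra.
have pG := intertwined_pisom pi_nd FU ST.
have opG := intertwined_op pi FU S T.
(* Adjoints are included because a moment with the new vector in the first slot becomes a product of
   that vector with a* S_j. *)
pose L := [seq (bnet_rep pi a (S j), bnet_rep pi a (T j))
  | a <- s ++ map star s, j <- iota 0 n].
have LG p : p \in L -> semi_closure B (intertwined pi S T) p.1 p.2.
  move=> /allpairsP[[a j] [/= _ _ ->]]; apply: (op_stable (opG a)) => d d0.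
  have z (w : bnet H (nat * seq A)) : B (w - w) (w - w) < d.
    by rewrite subrr -(scale0r 0) /B (lim_innerZl FU) mul0r.
  by exists (S j), (T j); split; [exact: intertwined_gen | exact: z | exact: z].
have y1 : B y y <= 1.
  rewrite leNgt; apply/negP; rewrite -subr_gt0 => d0.
  have [l /=] := filter_ex (lim_inner_near FU y y d0).
  have := svalP (P l).2; rewrite norm_le1E.
  rewrite -/(B y y) ltr_norml => h /andP[_]; lra.
(* The first component of the index witnesses the countable incompleteness of [F]. *)
have N_oo m : F [set i : nat * seq A | (m <= i.1)%N].
  by apply: momF; exists m, [::].
have [x [x1 xx xL]] := pisom_extension_ball (lim_innerC FU) (lim_innerDl FU)
  (lim_innerZl FU) (lim_inner_ge0 FU) (lim_inner_complete FU N_oo) s pG opG LG y1 e0.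
pose S' j : bnet H _ := if j == k then y else S j.
pose T' j : bnet H _ := if j == k then x else T j.
have S'E l j : S' j l = sval (update (P l).1.1 k (P l).2 j).
  by rewrite /S' /update; case: ifP.
have ST' a i j : a \in s -> (i < n)%N -> (j < n)%N ->
    `|B (bnet_rep pi a (S' i)) (S' j) - B (bnet_rep pi a (T' i)) (T' j)| < e.
  have xL' b l : b \in s ++ map star s -> (l < n)%N ->
      `|B x (bnet_rep pi b (T l)) - B y (bnet_rep pi b (S l))| < e.
    move=> bs ln; apply: (xL (bnet_rep pi b (S l), bnet_rep pi b (T l))).
    by apply/allpairsP; exists (b, l); rewrite mem_iota.
  move=> as_ im jm; rewrite /S' /T'; case: eqP => _; case: eqP => _.
  - by rewrite distrC; exact: xx.
  - rewrite /B !(bnet_rep_adj pi) distrC; apply: xL' => //.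
    by rewrite mem_cat map_f// orbT.
  - rewrite /B !(lim_innerC FU (bnet_rep _ _ _)) distrC; apply: xL' => //.
    by rewrite mem_cat as_.
  - by rewrite ST subrr normr0.
have FST : F [set l | forall a, a \in s -> forall i, i \in iota 0 n ->
    forall j, j \in iota 0 n ->
    `|moment (update (P l).1.1 k (P l).2) a i j
      - re_inner (pi a (T' i l)) (T' j l)| < e].
  apply: (@filter_forall_mem _ F _ (fun a l => forall i, i \in iota 0 n ->
    forall j, j \in iota 0 n -> `|moment (update (P l).1.1 k (P l).2) a i j
      - re_inner (pi a (T' i l)) (T' j l)| < e)) => a as_.
  apply: (@filter_forall_mem _ F _ (fun i l => forall j, j \in iota 0 n ->
    `|moment (update (P l).1.1 k (P l).2) a i j
      - re_inner (pi a (T' i l)) (T' j l)| < e)) => i im.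
  apply: (@filter_forall_mem _ F _ (fun j l =>
    `|moment (update (P l).1.1 k (P l).2) a i j
      - re_inner (pi a (T' i l)) (T' j l)| < e)) => j jm.
  move: im jm; rewrite !mem_iota => /andP[_ im] /andP[_ jm].
  have := ST' a i j as_ im jm; set D := _ - _ => De.
  (* The strict inequality between the limits leaves room for two approximation errors at a
     coordinate. *)
  have e2 : 0 < (e - `|D|) / 2 by lra.
  apply: filterS (filterI (lim_inner_near FU (bnet_rep pi a (S' i)) (S' j) e2)
    (lim_inner_near FU (bnet_rep pi a (T' i)) (T' j) e2)) => l [/=].
  rewrite -/(B _ _) -/(B _ _) /moment !S'E.
  move: De e2; rewrite /D.
  move: (B _ _) (B _ _) (re_inner _ _) (re_inner _ _) => p q v w De e2 h1 h2.
  have := ler_normD (w - q) (q - p).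
  have := ler_normD (w - q + (q - p)) (p - v).
  have -> : w - q + (q - p) + (p - v) = w - v by ring.
  by rewrite (distrC w q); lra.
have x1F : F [set l | `|x l| <= 1].
  have d0 : 0 < 1 - B x x by rewrite subr_gt0.
  apply: filterS (lim_inner_near FU x x d0) => l /=.
  rewrite norm_le1E -/(B x x) ltr_norml => /andP[h _]; lra.
have [l [/= Hl xl]] := filter_ex (filterI FST x1F).
pose x' : unit_ball H := exist (fun v : H => is_true (`|v| <= 1)) (x l) xl.
have T'E h : T' h l = sval (update (P l).1.2 k x' h).
  by rewrite /T' /update; case: ifP.
have [_ /(_ x')] := PP l; apply=> a i j as_ im jm.
have := Hl a as_ i _ j _; rewrite !mem_iota => /(_ im jm).
by rewrite !T'E.
Qed.
End UniformExtension.

(** Heine-Cantor by ultrafilters: for ever closer pairs violating the bound, the first points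
    converge in the compact cube to some z, and continuity at z contradicts the gap [e]. *)
Lemma connective_unif_continuous (R : realType) n (u : connective R n) (e : R) :
  0 < e -> exists2 d : R, 0 < d & forall x y, unit_cube x -> unit_cube y ->
    (forall i, `|x ord0 i - y ord0 i| < d) -> `|u x - u y| <= e.
Proof.
move=> e0; apply: contrapT => no.
have /choice[p pP] : forall k : nat, exists p : 'rV[R]_n * 'rV[R]_n,
    [/\ unit_cube p.1, unit_cube p.2,
        forall i, `|p.1 ord0 i - p.2 ord0 i| < k.+1%:R^-1 & e < `|u p.1 - u p.2|].
  move=> k; apply: contrapT => no'; apply: no; exists k.+1%:R^-1; first by rewrite invr_gt0.
  move=> x y xc yc xy; rewrite leNgt; apply/negP => exy; apply: no'.
  by exists (x, y).
have [F [FU oF]] := ultraFilterLemma eventually_filter.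
have PF : ProperFilter F by exact: ultra_proper.
have cpt : compact (@unit_cube R n).
  rewrite (_ : @unit_cube R n =
      [set v : 'rV[R]_n | forall i, `[0, 1]%classic (v ord0 i)]).
    by apply: (@rV_compact R n (fun=> `[0, 1]%classic)) => _; exact: segment_compact.
  by apply/seteqP; split=> v h i; have := h i; rewrite /= in_itv.
have FpU := fmap_ultra (fun k => (p k).1) FU.
move: cpt; rewrite compact_ultra => /(_ _ FpU) [|z [zc pz]].
  by apply: (@filterS _ F _ setT) filterT => k _; case: (pP k).
have e2 : 0 < e / 2 by lra.
have /subspace_continuousP/(_ z zc)/cvgrPdist_lt/(_ _ e2) := @conn_continuous R n u.
rewrite near_withinE => /nbhs_ballP[d /= d0 Hd].
have d2 : 0 < d / 2 by lra.
have Fz : F [set k | ball z (d / 2) (p k).1] by apply: pz; exact: nbhsx_ballx.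
have [N _ HN] := near_infty_natSinv_lt (PosNum d2).
have FN : F [set k | (N <= k)%N] by apply: oF; exists N.
have [k [/= [_ zp] Nk]] := filter_ex (filterI Fz FN).
have [c1 c2 pd ep] := pP k.
have b1 : ball z d (p k).1.
  split=> // i j; apply: le_ball (zp i j); lra.
have b2 : ball z d (p k).2.
  split=> // i j; have := zp i j; rewrite (ord1 i) /ball/= => h.
  have := lt_trans (pd j) (HN _ Nk).
  have := ler_normD (z ord0 j - (p k).1 ord0 j)
    ((p k).1 ord0 j - (p k).2 ord0 j).
  by rewrite addrA subrK /=; lra.
have := Hd _ b1 c1; have := Hd _ b2 c2.
have := ler_normD (u (p k).1 - u z) (u z - u (p k).2).
rewrite addrA subrK (distrC (u (p k).1) (u z)); lra.
Qed.

(** * Moment continuity of formulas *)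

Section MomentContinuity.
Variables (R : realType) (A : cstarAlgebraType R) (H : hilbertType R).
Variables (pi : representation A H) (pi_nd : nondegenerate_rep pi).
Implicit Types rho : nat -> unit_ball H.

(** Continuity is uniform because the quantifier steps need one modulus for all values of the bound
    variable; finitely many moments are tested, as required by [uniform_extension]. *)
Definition moment_continuous (f : (nat -> unit_ball H) -> R) :=
  forall e, 0 < e -> exists d m (u : seq A), 0 < d /\
    forall rho rho', moments_close pi d m u rho rho' -> `|f rho - f rho'| <= e.

Lemma moments_close_sym d m u rho rho' :
  moments_close pi d m u rho rho' -> moments_close pi d m u rho' rho.
Proof. by move=> h a i j au im jm; rewrite distrC; exact: h. Qed.

Lemma moments_close_le d m u d' m' u' rho rho' : d' <= d -> (m <= m')%N ->
  {subset u <= u'} -> moments_close pi d' m' u' rho rho' ->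
  moments_close pi d m u rho rho'.
Proof.
move=> dd mm uu h a i j au im jm; apply: lt_le_trans dd; apply: h; first exact: uu.
  exact: leq_trans mm.
exact: leq_trans mm.
Qed.

(** Closeness is symmetric, so a one-sided estimate suffices, which suits suprema and infima. *)
Lemma moment_continuous_le f :
  (forall e, 0 < e -> exists d m (u : seq A), 0 < d /\
    forall rho rho', moments_close pi d m u rho rho' -> f rho <= f rho' + e) ->
  moment_continuous f.
Proof.
move=> h e /h[d [m [u [d0 H1]]]]; exists d, m, u; split=> // rho rho' cl.
have := H1 _ _ cl; have := H1 _ _ (moments_close_sym cl).
by rewrite ler_norml => *; apply/andP; split; lra.
Qed.

Lemma moment_continuous_family (T : eqType) (s : seq T) f (e : R) :
  (forall t, t \in s -> moment_continuous (f t)) -> 0 < e ->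
  exists d m (u : seq A), 0 < d /\
    forall rho rho', moments_close pi d m u rho rho' ->
      forall t, t \in s -> `|f t rho - f t rho'| <= e.
Proof.
move=> + e0; elim: s => [|t s IH] h; first by exists 1, 0%N, [::].
have [|d [m [u [d0 H1]]]] := IH; first by move=> t' ts; apply: h; rewrite inE ts orbT.
have [d' [m' [u' [d'0 H2]]]] := h t (mem_head _ _) _ e0.
exists (Num.min d d'), (maxn m m'), (u ++ u'); split; first by rewrite lt_min d0.
move=> rho rho' cl t'; rewrite inE => /predU1P[->|t's].
  apply: H2; apply: moments_close_le cl; rewrite ?ge_min ?lexx ?orbT ?leq_maxr//.
  by move=> a au; rewrite mem_cat au orbT.
apply: H1 => //; apply: moments_close_le cl; rewrite ?ge_min ?lexx ?leq_maxl//.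
by move=> a au; rewrite mem_cat au.
Qed.

Lemma moment_continuousD f g : moment_continuous f -> moment_continuous g ->
  moment_continuous (fun rho => f rho + g rho).
Proof.
move=> fc gc e e0; have e2 : 0 < e / 2 by lra.
have [|d [m [u [d0 H1]]]] := @moment_continuous_family bool [:: true; false]
    (fun b => if b then f else g) (e / 2) _ e2; first by case.
exists d, m, u; split=> // rho rho' /H1 h.
have := h true isT; have := h false isT.
by rewrite !ler_norml => /andP[? ?] /andP[? ?]; apply/andP; split; lra.
Qed.

Lemma moment_continuousZ k f : moment_continuous f ->
  moment_continuous (fun rho => k * f rho).
Proof.
move=> fc e e0; have k0 : 0 < `|k| + 1 by rewrite ltr_wpDl.
have [d [m [u [d0 H1]]]] := fc _ (divr_gt0 e0 k0).
exists d, m, u; split=> // rho rho' /H1; rewrite ler_pdivlMr// -mulrBr normrM => h.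
by apply: le_trans h; rewrite mulrC ler_wpM2l// lerDl.
Qed.

Lemma moment_continuous_cst c : moment_continuous (fun=> c).
Proof. by move=> e e0; exists 1, 0%N, [::]; split=> // *; rewrite subrr normr0 ltW. Qed.

Lemma moment_continuous_ext f g : (forall rho, f rho = g rho) ->
  moment_continuous f -> moment_continuous g.
Proof. by move=> fg; have -> : g = f by apply/funext => rho; rewrite fg. Qed.

Lemma moment_continuous_sqrt f :
  (forall rho, 0 <= f rho) -> moment_continuous f ->
  moment_continuous (fun rho => Num.sqrt (f rho)).
Proof.
move=> f0 fc; apply: moment_continuous_le => e e0.
(* The accuracy e^2 is used because sqrt (s + e^2) <= sqrt s + e. *)
have [d [m [u [d0 H1]]]] := fc _ (exprn_gt0 2 e0).
exists d, m, u; split=> // rho rho' /H1; rewrite ler_norml => /andP[_ h].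
have s0 := sqrtr_ge0 (f rho').
have le : f rho <= (Num.sqrt (f rho') + e) ^+ 2.
  have := sqr_sqrtr (f0 rho'); have := mulr_ge0 s0 (ltW e0).
  move: (Num.sqrt _) s0 => q s0 *; nra.
by apply: (le_trans (ler_wsqrtr le)); rewrite sqrtr_sqr ger0_norm// addr_ge0// ltW.
Qed.

Lemma half_scale (x : H) : 2^-1 *: x = (2^-1)%:C *: x.
Proof. by rewrite rmorphV ?unitfE// rmorph_nat. Qed.

Lemma re_inner_half (x : H) :
  re_inner (2^-1 *: x) (2^-1 *: x) = 4^-1 * re_inner x x.
Proof. by rewrite half_scale re_innerZl re_innerC re_innerZl; field. Qed.

(** Every symbol is absorbed by linearity or by the coefficient: i turns [a] into i a, and a
    function symbol multiplies [a] on the right. *)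
Lemma term_moment_continuous_var (g : (nat -> unit_ball H) -> H) (t : term A) :
  (forall a i,
    moment_continuous (fun rho => re_inner (pi a (sval (rho i))) (g rho))) ->
  forall a, moment_continuous
    (fun rho => re_inner (pi a (sval (term_eval pi rho t))) (g rho)).
Proof.
move=> gc; elim: t => [i||t IH|t IH|t IHt u IHu|b t IH] a /=; first exact: gc.
- apply: moment_continuous_ext (moment_continuous_cst 0) => rho.
  by rewrite linear0 re_inner0l.
- apply: moment_continuous_ext (moment_continuousZ (-1) (IH a)) => rho.
  by rewrite linearN re_innerNl mulN1r.
- apply: moment_continuous_ext (IH ('i *: a)) => rho.
  by rewrite rep_scale linearZ_LR.
- apply: moment_continuous_ext
    (moment_continuousZ 2^-1 (moment_continuousD (IHt a) (IHu a))) => rho.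
  by rewrite half_scale linearZ_LR linearD re_innerZl re_innerDl.
- by apply: moment_continuous_ext (IH (cmul a (sval b))) => rho; rewrite rep_mul.
Qed.

Lemma term_moment_continuous a (t t' : term A) : moment_continuous (fun rho =>
  re_inner (pi a (sval (term_eval pi rho t))) (sval (term_eval pi rho t'))).
Proof.
apply: term_moment_continuous_var => b i.
(* The adjoint exchanges the two slots, so the same induction on terms serves for both. *)
have h rho : re_inner (pi (star b) (sval (term_eval pi rho t'))) (sval (rho i)) =
    re_inner (pi b (sval (rho i))) (sval (term_eval pi rho t')).
  by rewrite rep_adjoint starK re_innerC.
apply: moment_continuous_ext h _; apply: term_moment_continuous_var => c j e e0.
exists e, (maxn i.+1 j.+1), [:: c]; split=> // rho rho' cl; apply/ltW/cl.
- exact: mem_head.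
- exact: leq_maxr.
- exact: leq_maxl.
Qed.

Lemma rnorm_sqrt (x : H) : rnorm x = Num.sqrt (re_inner x x).
Proof. by rewrite re_inner_rnorm sqrtr_sqr ger0_norm// rnorm_ge0. Qed.

Lemma rnorm_ball (x : unit_ball H) : 0 <= rnorm (sval x) <= 1.
Proof.
rewrite rnorm_ge0/= -[leRHS]sqrtr1 rnorm_sqrt ler_wsqrtr//.
by rewrite -norm_le1E; exact: svalP x.
Qed.

Lemma formula_eval_bounds (phi : formula A) rho : 0 <= formula_eval pi rho phi <= 1.
Proof.
elim: phi rho => [t u|t|n c args IH|k phi IH|k phi IH] rho /=.
(* The distance is the norm of a midpoint in the ball, hence at most 1. *)
- have := rnorm_ball (ball_mid (term_eval pi rho t) (ball_opp (term_eval pi rho u))).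
  by [].
- exact: rnorm_ball.
- by apply: conn_range => i; rewrite mxE.
- have ub : ubound (range (fun x => formula_eval pi (update rho k x) phi)) 1.
    by move=> _ [x _ <-]; case/andP: (IH (update rho k x)).
  apply/andP; split; last first.
    apply: ge_sup => //.
    by exists (formula_eval pi (update rho k (rho 0%N)) phi), (rho 0%N).
  apply: (@le_trans _ _ (formula_eval pi (update rho k (rho 0%N)) phi)).
    by case/andP: (IH (update rho k (rho 0%N))).
  by apply: ub_le_sup; [exists 1 | exists (rho 0%N)].
- have lb : lbound (range (fun x => formula_eval pi (update rho k x) phi)) 0.
    by move=> _ [x _ <-]; case/andP: (IH (update rho k x)).
  apply/andP; split.
    apply: lb_le_inf => //.
    by exists (formula_eval pi (update rho k (rho 0%N)) phi), (rho 0%N).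
  apply: (@le_trans _ _ (formula_eval pi (update rho k (rho 0%N)) phi)).
    by apply: ge_inf; [exists 0 | exists (rho 0%N)].
  by case/andP: (IH (update rho k (rho 0%N))).
Qed.

Lemma formula_moment_continuous (phi : formula A) :
  moment_continuous (fun rho => formula_eval pi rho phi).
Proof.
elim: phi => [t u|t|n c args IH|k phi IH|k phi IH] /=.
(* The squared distance is a combination of three moments at the unit, as [rep_unit] lets pi(1) be
   inserted. *)
- pose f (t u : term A) rho :=
    re_inner (pi cone (sval (term_eval pi rho t))) (sval (term_eval pi rho u)).
  have := moment_continuousZ 4^-1 (moment_continuousD (moment_continuousD
    (term_moment_continuous cone t t)
    (moment_continuousZ (-2) (term_moment_continuous cone t u)))
    (term_moment_continuous cone u u)).
  have E rho : 4^-1 * (f t t rho + -2 * f t u rho + f u u rho) =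
      ball_dist (term_eval pi rho t) (term_eval pi rho u) ^+ 2.
    rewrite /ball_dist -re_inner_rnorm /f !rep_unit//.
    rewrite re_inner_half !re_innerE.
    rewrite (re_innerC (sval (term_eval pi rho u)) (sval (term_eval pi rho t))).
    by field.
  move=> fc; apply: moment_continuous_ext (moment_continuous_sqrt _ fc) => rho.
    by rewrite E sqrtr_sqr ger0_norm// rnorm_ge0.
  by rewrite E sqr_ge0.
- apply: moment_continuous_ext
    (moment_continuous_sqrt _ (term_moment_continuous cone t t)) => rho.
    by rewrite rep_unit// -rnorm_sqrt.
  by rewrite rep_unit// re_inner_ge0.
- move=> e e0; have [d d0 Hd] := connective_unif_continuous c e0.
  have d2 : 0 < d / 2 by lra.
  have [|d' [m [u [d'0 H1]]]] := @moment_continuous_family _ (enum 'I_n)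
      (fun i rho => formula_eval pi rho (args i)) _ _ d2; first by move=> i _; exact: IH.
  exists d', m, u; split=> // rho rho' /H1 h; apply: Hd => i.
  + by rewrite mxE; exact: formula_eval_bounds.
  + by rewrite mxE; exact: formula_eval_bounds.
  + by rewrite !mxE; apply: le_lt_trans (h i (mem_enum _ _)) _; lra.
- apply: moment_continuous_le => e e0.
  have [d [m [u [d0 H1]]]] := IH _ e0.
  have [d' [m' [u' [d'0 H2]]]] := uniform_extension pi_nd k m u d0.
  exists d', m', u'; split=> // rho rho' cl.
  apply: ge_sup => [|_ [x _ <-]].
    by exists (formula_eval pi (update rho k (rho 0%N)) phi), (rho 0%N).
  have [x' cl'] := H2 _ _ cl x; have := H1 _ _ cl'.
  have : formula_eval pi (update rho' k x') phi <=
      sup (range (fun x => formula_eval pi (update rho' k x) phi)).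
    apply: ub_le_sup; last by exists x'.
    by exists 1 => _ [z _ <-]; case/andP: (formula_eval_bounds phi (update rho' k z)).
  by rewrite ler_norml => ? /andP[*]; lra.
- apply: moment_continuous_le => e e0.
  have [d [m [u [d0 H1]]]] := IH _ e0.
  have [d' [m' [u' [d'0 H2]]]] := uniform_extension pi_nd k m u d0.
  exists d', m', u'; split=> // rho rho' cl; rewrite -lerBlDr.
  apply: lb_le_inf => [|_ [x _ <-]].
    by exists (formula_eval pi (update rho' k (rho' 0%N)) phi), (rho' 0%N).
  (* For an infimum the roles are exchanged: a point chosen over [rho'] is matched over [rho]. *)
  have [x' cl'] := H2 _ _ (moments_close_sym cl) x; have := H1 _ _ (moments_close_sym cl').
  have : inf (range (fun x => formula_eval pi (update rho k x) phi)) <=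
      formula_eval pi (update rho k x') phi.
    apply: ge_inf; last by exists x'.
    by exists 0 => _ [z _ <-]; case/andP: (formula_eval_bounds phi (update rho k z)).
  by rewrite ler_norml => ? /andP[*]; lra.
Qed.

Lemma formula_eval_moments rho rho' :
  (forall a i j, moment pi rho a i j = moment pi rho' a i j) ->
  forall phi, formula_eval pi rho phi = formula_eval pi rho' phi.
Proof.
move=> mm phi; apply/eqP; rewrite -subr_eq0 -normr_le0; apply/ler_addgt0Pl => e e0.
have [d [m [u [d0 H1]]]] := formula_moment_continuous phi e0.
rewrite addr0; apply: H1 => a i j _ _ _; by rewrite mm subrr normr0.
Qed.

(** * Recovering moments from types *)

Lemma dist_connective_range (c : R) (c01 : 0 <= c <= 1) (x : 'rV[R]_1) :
  unit_cube x -> 0 <= `|x ord0 ord0 - c| <= 1.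
Proof.
move=> /(_ ord0) /andP[? ?]; case/andP: c01 => ? ?.
by rewrite normr_ge0 ler_norml; apply/andP; split; lra.
Qed.

Lemma dist_connective_continuous (c : R) :
  {within @unit_cube R 1, continuous (fun x : 'rV[R]_1 => `|x ord0 ord0 - c|)}.
Proof.
apply: continuous_subspaceT => x.
have h := @coord_continuous R 1 1 ord0 ord0 x.
exact: (cvg_norm (cvgB h (cvg_cst c))).
Qed.

Definition dist_connective (c : R) (c01 : 0 <= c <= 1) : connective R 1 :=
  Connective (dist_connective_range c01) (@dist_connective_continuous c).

(** If [phi] takes the value c at [x], the condition |phi - c| = 0 belongs to the type of [x], hence
    to that of [y]. *)
Lemma tp_formula_eval (x y : unit_ball H) (phi : formula A) :
  tp pi x = tp pi y ->
  (forall k, free_var k phi -> k = 0%N) ->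
  formula_eval pi (fun=> x) phi = formula_eval pi (fun=> y) phi.
Proof.
move=> xy fv; set c := formula_eval pi (fun=> x) phi.
have c01 : 0 <= c <= 1 := formula_eval_bounds phi _.
have : tp pi x (FConn (dist_connective c01) (fun=> phi)).
  by split=> [k [j] | ]; [exact: fv | rewrite /= mxE subrr normr0].
rewrite xy => -[_]; rewrite /= mxE => /eqP.
by rewrite normr_eq0 subr_eq0 => /eqP.
Qed.

(** After scaling [a] to some [b] in the unit ball, Re <b z | z> = |(b z + z) / 2|^2 - |(b z - z) /
    2|^2, and both norms are values of atomic formulas. *)
Lemma tp_moment (x y : unit_ball H) a : tp pi x = tp pi y ->
  re_inner (pi a (sval x)) (sval x) = re_inner (pi a (sval y)) (sval y).
Proof.
move=> xy; have [k [b [k0 ->]]] := unit_ball_scale a.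
rewrite !rep_scale !re_innerZl; congr (_ * _).
pose plus : formula A := FNorm (TMid (TDot b (TVar 0)) (TVar 0)).
pose minus : formula A := FNorm (TMid (TDot b (TVar 0)) (TOpp (TVar 0))).
have polar z : re_inner (pi (sval b) (sval z)) (sval z) =
    formula_eval pi (fun=> z) plus ^+ 2 - formula_eval pi (fun=> z) minus ^+ 2.
  rewrite /= -!re_inner_rnorm.
  rewrite !re_inner_half !re_innerE.
  rewrite (re_innerC (sval z) (pi (sval b) (sval z))); lra.
rewrite !polar (tp_formula_eval (phi := plus) xy) ?(tp_formula_eval (phi := minus) xy)//.
  by move=> j /= [].
by move=> j /= [].
Qed.

(** The imaginary part at [a] is minus the real part at i a. *)
Lemma vector_functional_moment (x y : H) :
  vector_functional pi x = vector_functional pi y <->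
  forall a, re_inner (pi a x) x = re_inner (pi a y) y.
Proof.
split=> [xy a|xy]; first by rewrite /re_inner -!/(vector_functional pi _ a) xy.
apply/funext => a; apply/eqP; rewrite /vector_functional eq_complex.
rewrite -!/(re_inner _ _) xy eqxx /= !im_inner.
by have := xy ('i *: a); rewrite !rep_scale => ->.
Qed.

End MomentContinuity.

Theorem theorem4p4 (R : realType) (A : cstarAlgebraType R) (H : hilbertType R)
    (pi : representation A H) (pi_nd : nondegenerate_rep pi) (v w : H)
    (r : R) (r0 : 0 < r) (vr : `|v| <= r%:C) (wr : `|w| <= r%:C) :
  tp pi (rescale r0 vr) = tp pi (rescale r0 wr) <->
  vector_functional pi v = vector_functional pi w.
Proof.
(* Rescaling multiplies all moments by the same nonzero factor, which cancels in both directions. *)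
have scale a (x : H) (xr : `|x| <= r%:C) :
    re_inner (pi a (sval (rescale r0 xr))) (sval (rescale r0 xr)) =
    r^-1 ^+ 2 * re_inner (pi a x) x.
  rewrite /= linearZ_LR re_innerZl re_innerC re_innerZl re_innerC mulrA expr2.
  by [].
split=> [vw | /vector_functional_moment vw].
  apply/vector_functional_moment => a; have := tp_moment a vw.
  rewrite !scale => /mulfI; apply.
  by rewrite expf_neq0// invr_eq0 lt0r_neq0.
apply/seteqP; split=> phi [fv e0]; split=> //; rewrite -e0;
  apply: formula_eval_moments => // a i j; rewrite /moment !scale vw//.
Qed.
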